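(* Let $M\ge 1$ be an integer, $\alpha_{\rm c}>0$, $p>0$, and let $\mathbf h_{\rm c}\sim\mathcal{CN}(\mathbf 0,\alpha_{\rm c}\mathbf I)$ be a random vector in $\mathbb C^{M\times 1}$. The ergodic communication rate of the communications-centric design, $\mathcal R_{\rm c}^{\rm c}=\mathbb E\{\log_2(1+p\lVert\mathbf h_{\rm c}\rVert^2)\}$, is given by $$\mathcal R_{\rm c}^{\rm c}=\sum_{\mu=0}^{M-1}\frac{(-1/(p\alpha_{\rm c}))^{M-1-\mu}}{(M-1-\mu)!\,\ln 2}\left(-e^{\frac{1}{p\alpha_{\rm c}}}\,\mathrm{Ei}\!\left(\frac{-1}{p\alpha_{\rm c}}\right)+\sum_{i=1}^{M-1-\mu}(i-1)!\left(-\frac{1}{p\alpha_{\rm c}}\right)^{-i}\right).$$ Moreover, as $p\to\infty$, $$\mathcal R_{\rm c}^{\rm c}\approx\log_2 p+\log_2\alpha_{\rm c}+\frac{\psi(M)}{\ln 2}.$$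
   Context: A base station with $M$ transmit antennas sends $\sqrt p\,\mathbf w\mathbf s^{\mathsf H}$ with power budget $p$ and unit-norm beamformer $\mathbf w\in\mathbb C^{M\times1}$; a single-antenna user with channel $\mathbf h_{\rm c}$ (known to the base station) and unit-variance Gaussian noise attains the communication rate $\log_2(1+p|\mathbf w^{\mathsf H}\mathbf h_{\rm c}|^2)$. The communications-centric design uses the rate-maximizing beamformer $\mathbf w_{\rm c}=\mathbf h_{\rm c}/\lVert\mathbf h_{\rm c}\rVert$, so its instantaneous rate is $\log_2(1+p\lVert\mathbf h_{\rm c}\rVert^2)$. $\mathcal{CN}(\mathbf 0,\alpha_{\rm c}\mathbf I)$ is the circularly symmetric complex Gaussian law: i.i.d. entries with mean zero and variance $\mathbb E|\cdot|^2=\alpha_{\rm c}$. For $x<0$, $\mathrm{Ei}(x)=-\int_{-x}^{\infty}e^{-t}t^{-1}\,dt$ is the exponential integral. $\psi(x)=\frac{d}{dx}\ln\Gamma(x)$ is the Digamma function, where $\Gamma$ is the gamma function. Empty sums are zero. For rates, ''$\approx$ as $p\to\infty$'' means that the difference of the two sides tends to $0$. *)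

(* Defs.v *)
From HB Require Import structures.
From mathcomp Require Import all_boot all_order all_algebra.
From mathcomp Require Import all_classical all_reals all_analysis.
From mathcomp Require Import complex.

Set Implicit Arguments.
Unset Strict Implicit.
Unset Printing Implicit Defensive.

Import Order.TTheory GRing.Theory Num.Theory.
Import numFieldNormedType.Exports.

Local Open Scope classical_set_scope.
Local Open Scope ring_scope.

Definition log2 {R : realType} (x : R) : R := ln x / ln 2.

(** Exponential integral; used only for [x < 0], where the integral converges. *)
Definition Ei {R : realType} (x : R) : R :=
  - \int[lebesgue_measure]_(t in `[- x, +oo[) (expR (- t) / t).

(** Euler's integral; used only near positive [x], where it converges. *)
Definition Gamma {R : realType} (x : R) : R :=
  \int[lebesgue_measure]_(t in `]0, +oo[) (t `^ (x - 1) * expR (- t)).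

Definition digamma {R : realType} (x : R) : R :=
  derive1 (fun y : R => ln (Gamma y)) x.

(** The Euclidean norm: the library norm on matrices is the sup norm. *)
Definition norm2 {R : realType} {M : nat} (v : 'cV[R[i]]_M) : R :=
  Num.sqrt (\sum_(i < M) Normc.normc (v i ord0) ^+ 2).

(** [R[i]] carries no measurable structure: it is identified with the product
    of two copies of the Borel line. *)
Definition complex_pair {R : realType} (z : R[i]) :
    measurableTypeR R * measurableTypeR R :=
  (complex.Re z, complex.Im z).

Definition mutually_independent {R : realType} {d d' : measure_display}
    {T : measurableType d} {E : measurableType d'} (P : probability T R)
    {I : finType} (X : I -> T -> E) : Prop :=
  forall (J : {set I}) (B : I -> set E), (forall i, measurable (B i)) ->
    P (\bigcap_(i in [set` J]) (X i @^-1` B i)) =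
    (\prod_(i in J) P (X i @^-1` B i))%E.

(** The law CN(0, alpha) on the plane: the real and imaginary parts are
    independent centred Gaussians of variance [alpha / 2] each, so that
    E|z|^2 = [alpha]. The second parameter of [normal_prob] is the standard
    deviation. *)
Definition cgauss_prob {R : realType} (alpha : R) :
    set (measurableTypeR R * measurableTypeR R) -> \bar R :=
  (normal_prob 0 (Num.sqrt (alpha / 2)) \x
   normal_prob 0 (Num.sqrt (alpha / 2)))%E.

Definition is_cgauss_vector {R : realType} {d : measure_display}
    {T : measurableType d} (P : probability T R) {M : nat} (alpha : R)
    (h : T -> 'cV[R[i]]_M) : Prop :=
  let entry (i : 'I_M) (w : T) := complex_pair (h w i ord0) in
  [/\ forall i, measurable_fun [set: T] (entry i),
      forall i B, measurable B -> pushforward P (entry i) B = cgauss_prob alpha B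
    & mutually_independent P entry].

(** For the rate-maximizing unit beamformer [w = h / ||h||], the gain
    [|w^H h|^2] is [||h||^2]; [p] is the power budget and the noise has unit
    variance. *)
Definition ergodic_rate {R : realType} {d : measure_display}
    {T : measurableType d} (P : probability T R) {M : nat}
    (h : T -> 'cV[R[i]]_M) (p : R) : \bar R :=
  'E_P[fun w => log2 (1 + p * norm2 (h w) ^+ 2)]%E.

(* Main.v *)
(* Write N = ||h||^2.  The law of N is not needed, only its Laplace transform
   E exp(-s N) = (1 + alpha s)^-M, which factors over the independent entries.
   Frullani's formula
     ln(1 + r) = int_0^oo (1 - exp(-r u)) exp(-u) / u du
   and Tonelli's theorem give, with a = p alpha,
     E ln(1 + p N) = int_0^oo (1 - (1 + a u)^-M) exp(-u) / u du,
   and a geometric sum splits the right-hand side into the integrals of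
   a exp(-u) (1 + a u)^-j for j = 1, ..., M.  The one with j = 1 is
   - exp(1/a) Ei(-1/a), and integration by parts yields the others.
   The same Tonelli argument for a variable G of law Gamma(M, 1) gives
   E ln(1 + p N) = E ln(1 + a G).  Differentiating under the integral,
   psi(M) = E ln G, hence
     0 <= E ln(1 + p N) - ln a - psi(M) = E ln(1 + 1/(a G))
       <= 2 a^(-1/2) E G^(-1/2),
   which tends to 0. *)
Require Import Defs.
From HB Require Import structures.
From mathcomp Require Import all_boot all_order all_algebra.
From mathcomp Require Import all_classical all_reals all_analysis.
From mathcomp Require Import measurable_realfun complex ring lra.

Set Implicit Arguments.
Unset Strict Implicit.
Unset Printing Implicit Defensive.

Import Order.TTheory GRing.Theory Num.Theory.
Import numFieldNormedType.Exports.

Local Open Scope classical_set_scope.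
Local Open Scope ring_scope.

(** * Derivatives and the fundamental theorem of calculus *)

Lemma is_derive_exprn {R : realType} (n : nat) (x : R) :
  is_derive x 1 (fun t => t ^+ n) (n%:R * x ^+ n.-1).
Proof.
by apply: DeriveDef; [exact: exprn_derivable | rewrite exp_derive scaler1].
Qed.

Section ftc.
Context {R : realType}.
Implicit Types f F : R -> R.
Local Notation mu := (@lebesgue_measure R).

(** Continuity and derivatives are taken on both sides of every point, the endpoint included, which
    yields the one-sided conditions of the fundamental theorem at once; the integrands it is applied
    to extend smoothly past the endpoint. *)
Lemma ge0_integral_is_derive_y f F (a l : R) :
  (forall x, a <= x -> 0 <= f x) ->
  (forall x, a <= x -> {for x, continuous f}) ->
  (forall x, a <= x -> is_derive x 1 F (f x)) ->
  F x @[x --> +oo] --> l ->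
  (\int[mu]_(x in `[a, +oo[) (f x)%:E = (l - F a)%:E)%E.
Proof.
move=> f0 cf dF Fl.
rewrite (@ge0_continuous_FTC2y _ f F a l) ?EFinB//.
- apply/continuous_within_itvcyP; split.
    by move=> x; rewrite in_itv/= andbT => /ltW/cf.
  exact/cvg_at_right_filter/cf.
- by move=> x /ltW/dF [].
- apply: cvg_at_right_filter; apply: differentiable_continuous.
  by apply/derivable1_diffP; case: (dF a (lexx _)).
- by move=> x; rewrite in_itv/= andbT derive1E => /ltW/dF [].
Qed.

Lemma integral_is_derive f F (a b : R) : a < b ->
  (forall x, a <= x <= b -> {for x, continuous f}) ->
  (forall x, a <= x <= b -> is_derive x 1 F (f x)) ->
  (\int[mu]_(x in `[a, b]) (f x)%:E = (F b - F a)%:E)%E.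
Proof.
move=> ab cf dF.
have cF x : a <= x <= b -> {for x, continuous F}.
  move=> /dF [dFx _]; apply: differentiable_continuous.
  exact/derivable1_diffP.
rewrite (@continuous_FTC2 _ f F a b) ?EFinB//.
- apply/continuous_within_itvP => //; split.
  + by move=> x; rewrite in_itv/= => /andP[/ltW ax /ltW xb]; apply: cf; rewrite ax.
  + by apply/cvg_at_right_filter/cf; rewrite lexx ltW.
  + by apply/cvg_at_left_filter/cf; rewrite lexx ltW.
- split.
  + by move=> x; rewrite in_itv/= => /andP[/ltW ax /ltW xb]; case: (dF x); rewrite ?ax.
  + by apply/cvg_at_right_filter/cF; rewrite lexx ltW.
  + by apply/cvg_at_left_filter/cF; rewrite lexx ltW.
- move=> x; rewrite in_itv/= derive1E => /andP[/ltW ax /ltW xb].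
  by case: (dF x); rewrite ?ax.
Qed.

End ftc.

(** * Moments of the exponential law *)

Section exponential_moments.
Context {R : realType}.
Local Notation mu := (@lebesgue_measure R).

(** The Taylor bound [(c t)^(k+1) / (k+1)! <= exp (c t)] dominates the product by [C / t]. *)
Lemma exprn_expRN_cvg0 (k : nat) (c : R) : 0 < c ->
  t ^+ k * expR (- (c * t)) @[t --> +oo] --> (0 : R).
Proof.
move=> c0.
pose C : R := (k.+1)`!%:R / c ^+ k.+1.
apply/cvgrPdist_le => /= e e0; near=> t.
have t0 : 0 < t by near: t; apply: nbhs_pinfty_gt; rewrite num_real.
rewrite sub0r normrN ger0_norm; last by rewrite mulr_ge0 ?expR_ge0 ?exprn_ge0 ?ltW.
have : (c * t) ^+ k.+1 / k.+1`!%:R <= expR (c * t).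
  by apply: le_trans (expR_ge1Dxn k _); rewrite ?lerDr// mulr_ge0 ?ltW.
have ct : 0 < (c * t) ^+ k.+1 / k.+1`!%:R.
  by rewrite divr_gt0 ?exprn_gt0 ?mulr_gt0// ltr0n fact_gt0.
rewrite -lef_pV2 ?posrE ?expR_gt0// -expRN => h.
apply: (@le_trans _ _ (C / t)); last first.
  have : C / e <= t by near: t; apply: nbhs_pinfty_ge; rewrite num_real.
  by rewrite (ler_pdivrMr _ _ e0) (ler_pdivrMr _ _ t0) mulrC.
apply: le_trans (ler_wpM2l _ h) _; first by rewrite exprn_ge0// ltW.
rewrite invf_div exprMn invfM mulrCA /C -!mulrA ler_wpM2l ?ler0n//.
rewrite mulrCA ler_wpM2l ?invr_ge0 ?exprn_ge0 ?(ltW c0)//.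
by rewrite exprS invfM mulrCA divff ?mulr1// expf_neq0// gt_eqF.
Unshelve. all: by end_near. Qed.

(** For [c > 0], the antiderivative of [t^k exp (- c t)] that vanishes at infinity, in the recursive
    form given by integration by parts. *)
Fixpoint exp_moment_prim (c : R) (k : nat) (t : R) : R :=
  match k with
  | 0 => - (expR (- (c * t)) / c)
  | k.+1 => (k.+1%:R * exp_moment_prim c k t - t ^+ k.+1 * expR (- (c * t))) / c
  end.

Lemma is_derive_exp_moment_prim (c : R) (k : nat) (t : R) : 0 < c ->
  is_derive t 1 (exp_moment_prim c k) (t ^+ k * expR (- (c * t))).
Proof.
move=> c0; have cn0 : c != 0 by rewrite gt_eqF.
elim: k => [|k ih] /=.
  apply: is_derive_eq; rewrite /GRing.scale/=; field.
  by [].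
move: (exp_moment_prim c k) ih => F ih.
have dX := is_derive_exprn k.+1 t.
have dE : is_derive t 1 (fun s : R => expR (- (c * s))) (- c * expR (- (c * t))).
  by apply: is_derive_eq; rewrite /GRing.scale/=; ring.
apply: is_derive_eq; rewrite /GRing.scale/= exprS; field.
by [].
Qed.

Lemma exp_moment_prim_cvg0 (c : R) (k : nat) : 0 < c ->
  exp_moment_prim c k t @[t --> +oo] --> (0 : R).
Proof.
move=> c0; elim: k => [|k ih] /=.
  rewrite -oppr0; apply: cvgN; rewrite -(mul0r c^-1); apply: cvgMl.
  have := exprn_expRN_cvg0 0 c0.
  by under eq_fun do rewrite expr0 mul1r.
rewrite -(mul0r c^-1); apply: cvgMl.
rewrite -[X in _ --> X](subr0 0) -[X in _ --> X - _](mulr0 k.+1%:R).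
by apply: cvgB; [exact: cvgMr | exact: exprn_expRN_cvg0].
Qed.

Lemma exp_moment_prim0 (c : R) (k : nat) : 0 < c ->
  exp_moment_prim c k 0 = - (k`!%:R / c ^+ k.+1).
Proof.
move=> c0; elim: k => [|k ih] /=; first by rewrite mulr0 oppr0 expR0 expr1.
rewrite ih expr0n/= mul0r subr0 factS natrM (exprS c k.+1).
have cn0 : c != 0 by rewrite gt_eqF.
by field; rewrite ?expf_neq0 ?cn0.
Qed.

Lemma integral_exprn_expRN (c : R) (k : nat) : 0 < c ->
  (\int[mu]_(t in `[0%R, +oo[) (t ^+ k * expR (- (c * t)))%:E
   = (k`!%:R / c ^+ k.+1)%:E)%E.
Proof.
move=> c0.
transitivity ((0 - exp_moment_prim c k 0)%:E); last first.
  by rewrite exp_moment_prim0// sub0r opprK.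
apply: ge0_integral_is_derive_y.
- by move=> x x0; rewrite mulr_ge0 ?exprn_ge0 ?expR_ge0.
- move=> x _; apply: differentiable_continuous; apply/derivable1_diffP.
  by have dX := is_derive_exprn k x; exact: ex_derive.
- by move=> x _; exact: is_derive_exp_moment_prim.
- exact: exp_moment_prim_cvg0.
Qed.

Lemma integral_exprn_expRN_oy (c : R) (k : nat) : 0 < c ->
  (\int[mu]_(t in `]0%R, +oo[) (t ^+ k * expR (- (c * t)))%:E
   = (k`!%:R / c ^+ k.+1)%:E)%E.
Proof.
move=> c0; rewrite integral_itv_obnd_cbnd ?integral_exprn_expRN//.
apply/measurable_EFinP; apply: measurable_funTS; apply: measurable_funM.
  exact: exprn_measurable.
by apply: measurableT_comp => //; apply: measurableT_comp => //.
Qed.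

End exponential_moments.

(** * Tonelli's theorem on a rectangle *)

(** Extending [f] by zero outside the rectangle reduces this to the theorem on the whole product.
    Measurability and sign are then a matter of the rectangle only, which suits kernels with a
    factor [1 / u] on [u > 0]. *)
Lemma fubini_tonelli_setX {d1 d2 : measure_display} {T1 : measurableType d1}
    {T2 : measurableType d2} {R : realType}
    (m1 : {sigma_finite_measure set T1 -> \bar R})
    (m2 : {sigma_finite_measure set T2 -> \bar R})
    (D1 : set T1) (D2 : set T2) (f : T1 * T2 -> \bar R) :
  measurable D1 -> measurable D2 ->
  measurable_fun (D1 `*` D2) f ->
  (forall z, (D1 `*` D2) z -> (0 <= f z)%E) ->
  (\int[m1]_(x in D1) \int[m2]_(y in D2) f (x, y) =
   \int[m2]_(y in D2) \int[m1]_(x in D1) f (x, y))%E.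
Proof.
move=> mD1 mD2 mf f0.
have mD : measurable (D1 `*` D2) by exact: measurableX.
pose D : set (T1 * T2) := D1 `*` D2.
pose g := f \_ D.
have mg : measurable_fun setT g by exact/(measurable_restrictT _ _).1.
have g0 z : (0 <= g z)%E.
  by rewrite /g/patch; case: ifPn => // /[!inE]; exact: f0.
have E1 : (\int[m1]_(x in D1) \int[m2]_(y in D2) f (x, y) =
           \int[m1]_x \int[m2]_y g (x, y))%E.
  rewrite integral_mkcond; apply: eq_integral => x _; rewrite /patch.
  case: ifPn => D1x.
    rewrite [LHS]integral_mkcond; apply: eq_integral => y _; rewrite /g /patch.
    by congr (if _ then _ else _); rewrite in_setX/= D1x.
  rewrite integral0_eq// => y _; rewrite /g /patch ifF// in_setX/= (negbTE D1x)//.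
have E2 : (\int[m2]_(y in D2) \int[m1]_(x in D1) f (x, y) =
           \int[m2]_y \int[m1]_x g (x, y))%E.
  rewrite integral_mkcond; apply: eq_integral => x _; rewrite /patch.
  case: ifPn => D1x.
    rewrite [LHS]integral_mkcond; apply: eq_integral => y _; rewrite /g /patch.
    by congr (if _ then _ else _); rewrite in_setX/= D1x andbT.
  rewrite integral0_eq// => y _; rewrite /g /patch ifF// in_setX/= (negbTE D1x) andbF//.
by rewrite E1 E2 fubini_tonelli.
Qed.

(** * Frullani's formula and logarithmic means from Laplace transforms *)

Section frullani.
Context {R : realType}.
Local Notation mu := (@lebesgue_measure R).

Lemma integral_expRN_pos (c : R) : 0 < c ->
  (\int[mu]_(u in `]0%R, +oo[) (expR (- (c * u)))%:E = (c^-1)%:E)%E.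
Proof.
move=> c0; rewrite -[c^-1]mul1r -[1]/(0`!%:R) -[c in RHS]expr1.
rewrite -integral_exprn_expRN_oy//.
by apply: eq_integral => u _; rewrite expr0 mul1r.
Qed.

Lemma integral_exp_family (r u : R) : 0 < r -> 0 < u ->
  (\int[mu]_(s in `[0%R, r]) (expR (- ((1 + s) * u)))%:E =
   ((1 - expR (- (r * u))) * (expR (- u) / u))%:E)%E.
Proof.
move=> r0 u0.
pose F (s : R) := - (expR (- ((1 + s) * u)) / u).
transitivity ((F r - F 0)%:E); last first.
  congr EFin; rewrite /F addr0 mul1r mulrDl mul1r opprD expRD; field.
  by rewrite gt_eqF.
apply: integral_is_derive => //.
- move=> x _; apply: differentiable_continuous; apply/derivable1_diffP.
  exact: ex_derive.
- move=> x _; rewrite /F; apply: is_derive_eq; rewrite /GRing.scale/=; field.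
  by rewrite gt_eqF.
Qed.

Lemma integral_inv1D (r : R) : 0 < r ->
  (\int[mu]_(s in `[0%R, r]) ((1 + s)^-1)%:E = (ln (1 + r))%:E)%E.
Proof.
move=> r0; pose F (s : R) := ln (1 + s).
transitivity ((F r - F 0)%:E); last by rewrite /F addr0 ln1 subr0.
have x10 x : 0 <= x <= r -> 0 < 1 + x by move=> /andP[x0 _]; rewrite ltr_wpDr.
apply: integral_is_derive => // x /x10 x0.
- apply: cvgV; first by rewrite gt_eqF.
  by apply: cvgD; [exact: cvg_cst|exact: cvg_id].
- have dx := is_derive1_ln x0.
  by rewrite /F; apply: is_derive_eq; rewrite /GRing.scale/=; ring.
Qed.

(* Writing [ln (1 + r)] as the double integral of [exp (- (1 + s) u)] over
   [0 <= s <= r] and [u > 0], and exchanging. *)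
Lemma integral_frullani (r : R) : 0 <= r ->
  (\int[mu]_(u in `]0%R, +oo[) ((1 - expR (- (r * u))) * (expR (- u) / u))%:E
   = (ln (1 + r))%:E)%E.
Proof.
rewrite le_eqVlt => /predU1P[<-|r0].
  rewrite integral0_eq ?addr0 ?ln1// => u _.
  by rewrite mul0r oppr0 expR0 subrr mul0r.
transitivity (\int[mu]_(u in `]0%R, +oo[) \int[mu]_(s in `[0%R, r])
    (expR (- ((1 + s) * u)))%:E)%E.
  apply: eq_integral => u; rewrite inE/= in_itv/= andbT => u0.
  by rewrite integral_exp_family.
rewrite (@fubini_tonelli_setX _ _ _ _ _ mu mu _ _
  (fun z => (expR (- ((1 + z.2) * z.1)))%:E))//=.
- rewrite -integral_inv1D//; apply: eq_integral => s.
  rewrite inE/= in_itv/= => /andP[s0 _]; rewrite integral_expRN_pos//.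
  by rewrite ltr_wpDr.
- apply/measurable_EFinP; apply: measurable_funTS.
  apply: measurableT_comp => //; apply: measurableT_comp => //.
  by apply: measurable_funM => //; exact: measurable_funD.
Qed.

Lemma measurable_invr_pos : measurable_fun (`]0, +oo[%classic : set R) (fun u : R => u^-1).
Proof.
apply: open_continuous_measurable_fun => //.
move=> x; rewrite inE/= in_itv/= andbT => x0.
by apply: inv_continuous; rewrite gt_eqF.
Qed.

(** Frullani's formula at [r = p N x], followed by Tonelli, leaves for each [u] the Laplace
    transform at [0] and at [p u]. The weight [w] lets one statement serve both a random variable,
    with [w = 1], and a density against Lebesgue measure. *)
Lemma ge0_integral_ln1D_laplace {d : measure_display} {T : measurableType d}
    (m : {sigma_finite_measure set T -> \bar R}) (w N : T -> R) (phi : R -> R)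
    (p : R) :
  measurable_fun setT w -> measurable_fun setT N ->
  (forall x, 0 <= w x) -> (forall x, 0 <= N x) ->
  (forall s, 0 <= s ->
    (\int[m]_x (w x * expR (- (s * N x)))%:E = (phi s)%:E)%E) -> 0 <= p ->
  (\int[m]_x (w x * ln (1 + p * N x))%:E =
   \int[mu]_(u in `]0%R, +oo[)
     ((phi 0 - phi (p * u)) * (expR (- u) / u))%:E)%E.
Proof.
move=> mw mN w0 N0 L p0.
have frul_ge0 r u : 0 <= r -> 0 < u ->
    0 <= (1 - expR (- (r * u))) * (expR (- u) / u).
  move=> r0 u0; rewrite mulr_ge0 ?divr_ge0 ?expR_ge0 ?(ltW u0)//.
  by rewrite subr_ge0 expR_le1 oppr_le0 mulr_ge0// ltW.
have mexp s : measurable_fun setT (fun x => expR (- (s * N x))).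
  by apply: measurableT_comp => //; apply: measurableT_comp => //; exact: measurable_funM.
transitivity (\int[m]_x \int[mu]_(u in `]0%R, +oo[)
    (w x * ((1 - expR (- (p * N x * u))) * (expR (- u) / u)))%:E)%E.
  apply: eq_integral => x _.
  under eq_integral do rewrite EFinM.
  rewrite ge0_integralZl_EFin//=.
  - by rewrite integral_frullani ?mulr_ge0// EFinM.
  - move=> u; rewrite /= in_itv/= andbT lee_fin => u0.
    by rewrite frul_ge0// mulr_ge0.
  - apply/measurable_EFinP; apply: measurable_funM.
      apply: measurable_funTS; apply: measurable_funB => //.
      by apply: measurableT_comp => //; apply: measurableT_comp => //; exact: measurable_funM.
    apply: measurable_funM; last exact: measurable_invr_pos.
    by apply: measurable_funTS; exact: measurableT_comp.
rewrite (@fubini_tonelli_setX _ _ _ _ _ m mu _ _ (fun z =>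
  (w z.1 * ((1 - expR (- (p * N z.1 * z.2))) * (expR (- z.2) / z.2)))%:E))//=.
- apply: eq_integral => u; rewrite inE/= in_itv/= andbT => u0.
  pose c := expR (- u) / u.
  have c0 : 0 <= c by rewrite divr_ge0 ?expR_ge0 ?ltW.
  under eq_integral do rewrite (mulrA (w _)) (mulrC _ c) EFinM.
  have h0 x : 0 <= w x * (1 - expR (- (p * N x * u))).
    rewrite mulr_ge0// subr_ge0 expR_le1 oppr_le0.
    by rewrite !mulr_ge0// ltW.
  have mh : measurable_fun setT (fun x => w x * (1 - expR (- (p * N x * u)))).
    apply: measurable_funM => //; apply: measurable_funB => //.
    by under eq_fun do rewrite mulrAC; exact: mexp.
  rewrite ge0_integralZl_EFin//=; last exact/measurable_EFinP; last first.
    by move=> x _; rewrite lee_fin.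
  rewrite [RHS]EFinM [RHS]muleC; congr (_ * _)%E.
  have pu0 : 0 <= p * u by rewrite mulr_ge0// ltW.
  (* Extended reals do not subtract freely: the two nonnegative integrals are added to give [phi 0],
     and the second, which is finite, is then moved across. *)
  have : (\int[m]_x (w x * (1 - expR (- (p * N x * u))))%:E +
      \int[m]_x (w x * expR (- (p * u * N x)))%:E = (phi 0)%:E)%E.
    rewrite -ge0_integralD//=.
    + rewrite -(L 0)//; apply: eq_integral => x _.
      by rewrite mul0r oppr0 expR0 -EFinD mulrAC -mulrDr subrK.
    + by move=> x _; rewrite lee_fin.
    + exact/measurable_EFinP.
    + by move=> x _; rewrite lee_fin mulr_ge0// expR_ge0.
    + by apply/measurable_EFinP; exact: measurable_funM.
  rewrite (L _ pu0) => h; rewrite EFinB -h addeK//.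
- apply/measurable_EFinP; apply: measurable_funM.
    by apply: measurable_funTS; exact: measurableT_comp.
  apply: measurable_funM.
    apply: measurable_funTS; apply: measurable_funB => //.
    apply: measurableT_comp => //; apply: measurableT_comp => //.
    apply: measurable_funM => //; apply: measurable_funM => //.
    exact: measurableT_comp.
  apply: measurable_funM.
    apply: measurable_funTS; apply: measurableT_comp => //.
    exact: measurableT_comp.
  rewrite (_ : (fun _ => _) = (fun u : R => u^-1) \o snd)//.
  apply: (@measurable_comp _ _ _ _ _ _ (`]0%R, +oo[%classic : set R)) => //.
  + by move=> _ [z /= [_ ?] <-].
  + exact: measurable_invr_pos.
  + exact: measurable_funTS.
- move=> [x u] [_ /=]; rewrite in_itv/= andbT lee_fin => u0.
  by rewrite mulr_ge0// frul_ge0// mulr_ge0.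
Qed.

End frullani.

(** * The rate integral in closed form *)

Section rate_integral.
Context {R : realType}.
Local Notation mu := (@lebesgue_measure R).

(* [rate_coef a^-1 J0 k] is the integral of [a exp(-u) (1 + a u)^-(k+1)] over
   [u > 0], by integration by parts from the case [k = 0]. *)
Fixpoint rate_coef (x J0 : R) (k : nat) : R :=
  if k is k'.+1 then (1 - x * rate_coef x J0 k') / k'.+1%:R else J0.

(** Induction on [k]: the summand [i = k + 1] that the sum gains contributes exactly [1 / (k + 1)],
    the constant term of the recursion. *)
Lemma rate_coefE (x J0 : R) (k : nat) : x != 0 ->
  rate_coef x J0 k = (- x) ^+ k / k`!%:R *
    (J0 + \sum_(1 <= i < k.+1) (i - 1)`!%:R * (- x) ^- i).
Proof.
move=> x0; elim: k => [|k ih].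
  by rewrite big_geq// addr0 expr0 fact0 divr1 mul1r.
rewrite big_nat_recr//= {}ih; set S := \sum_(1 <= i < k.+1) _.
rewrite subn1/= factS natrM exprS; field.
by rewrite expf_neq0 ?oppr_eq0// x0 nat1r !pnatr_eq0 -lt0n fact_gt0.
Qed.

Variable a : R.
Hypothesis a0 : 0 < a.

Let D0 (u : R) : 0 <= u -> 0 < 1 + a * u.
Proof. by move=> u0; rewrite ltr_wpDr// mulr_ge0// ltW. Qed.

Let kern k (u : R) : R := a * expR (- u) / (1 + a * u) ^+ k.

Let kern_ge0 (k : nat) (u : R) : 0 <= u -> 0 <= kern k u.
Proof.
by move=> u0; rewrite divr_ge0 ?exprn_ge0 ?(ltW (D0 _))// mulr_ge0 ?expR_ge0// ltW.
Qed.

(** Integrated over [u >= 0], this relation between consecutive kernels becomes the recursion of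
    [rate_coef]. *)
Let is_derive_kern (k : nat) (u : R) : 0 <= u -> is_derive u 1 (kern k)
  (- kern k u - k%:R * a * kern k.+1 u).
Proof.
move=> u0; have n0 : 1 + a * u != 0 by rewrite gt_eqF// D0.
have dI : is_derive u 1 (fun t : R => (1 + a * t)) a.
  by apply: is_derive_eq; rewrite /GRing.scale/=; ring.
have dX := is_derive_exprn k (1 + a * u).
have dP : is_derive u 1 (fun t : R => (1 + a * t) ^+ k)
    (k%:R * (1 + a * u) ^+ k.-1 * a).
  by have := @is_derive1_comp _ (fun t => t ^+ k) (fun t => 1 + a * t) u _ _ dX dI.
have dV : is_derive u 1 (fun t : R => ((1 + a * t) ^+ k)^-1)
    (- (k%:R * a / (1 + a * u) ^+ k.+1)).
  have nk : (1 + a * u) ^+ k != 0 by rewrite expf_neq0.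
  have := @is_deriveV _ (fun t => (1 + a * t) ^+ k) _ _ _ nk dP.
  move=> /is_derive_eq; apply.
  (* At [k = 0] the exponent [k.-1] is truncated to [0], but the factor [k%:R] vanishes. *)
  rewrite /GRing.scale/=; case: k {dX dP nk} => [|k]; first by rewrite !mul0r mulr0 oppr0.
  by rewrite /= !exprS; field; rewrite ?expf_neq0 ?n0.
rewrite /kern; apply: is_derive_eq.
by rewrite /GRing.scale/= exprS; field; rewrite ?expf_neq0 ?n0.
Qed.

Let continuous_kern (k : nat) (u : R) : 0 <= u -> {for u, continuous (kern k)}.
Proof.
move=> u0; apply: differentiable_continuous; apply/derivable1_diffP.
by case: (is_derive_kern k u0).
Qed.

Let measurable_kern (k : nat) : measurable_fun (`[0, +oo[%classic : set R) (kern k).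
Proof.
have -> : kern k = (fun u => a * expR (- u) * (1 + a * u) ^- k) by [].
apply: subspace_continuous_measurable_fun => //.
apply/continuous_within_itvcyP; split.
  by move=> x; rewrite in_itv/= andbT => /ltW; exact: continuous_kern.
by apply: cvg_at_right_filter; exact: continuous_kern.
Qed.

Let kern_cvg0 (k : nat) : kern k u @[u --> +oo] --> (0 : R).
Proof.
have h : a * expR (- u) @[u --> +oo] --> (0 : R).
  rewrite -(mulr0 a); apply: cvgMr; exact: cvgr_expR.
apply: (@squeeze_cvgr _ _ _ _ (fun=> 0) (fun u => a * expR (- u))) => //.
  near=> u; have u0 : 0 <= u by near: u; apply: nbhs_pinfty_ge; rewrite num_real.
  rewrite kern_ge0//= ler_pdivrMr ?exprn_gt0 ?D0// ler_peMr//.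
    by rewrite mulr_ge0 ?expR_ge0// ltW.
  by rewrite exprn_ege1// lerDl mulr_ge0// ltW.
exact: cvg_cst.
Unshelve. all: by end_near. Qed.

(** The substitution [t = 1/a + u]: the integrand equals [exp (1/a)] times [exp (- t) / t]. *)
Lemma integral_kern1_Ei :
  (\int[mu]_(u in `[0%R, +oo[) (a * expR (- u) / (1 + a * u))%:E =
   (- expR a^-1 * Ei (- a^-1))%:E)%E.
Proof.
have x0 : 0 < a^-1 by rewrite invr_gt0.
pose G (t : R) := expR (- t) / t.
pose F (u : R) := a^-1 + u.
have dF (u : R) : is_derive u 1 F 1.
  have := @is_deriveD R R R (cst a^-1) id u 1 0 1 _ _.
  by rewrite add0r; apply.
have F'E : derive1 F = cst 1 by apply/funext => u; rewrite derive1E derive_val.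
have cG (t : R) : 0 < t -> {for t, continuous G}.
  move=> t0.
  have cE : {for t, continuous (fun s : R => expR (- s))}.
    apply: differentiable_continuous; apply/derivable1_diffP.
    exact: ex_derive.
  by apply: (cvgM cE); apply: inv_continuous; rewrite gt_eqF.
have E : (\int[mu]_(t in `[(a^-1)%R, +oo[) (G t)%:E =
    \int[mu]_(u in `[0%R, +oo[) (G (a^-1 + u))%:E)%E.
  have -> : a^-1 = F 0 by rewrite /F addr0.
  rewrite (@increasing_ge0_integration_by_substitutiony _ F G 0).
  - by apply: eq_integral => u _; rewrite F'E /= mulr1 /F addr0.
  - by move=> u v _ _ uv; rewrite ltrD2l.
  - by rewrite F'E => u _; exact: cvg_cst.
  - by rewrite F'E; exact: is_cvg_cst.
  - by rewrite F'E; exact: is_cvg_cst.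
  - split; first by move=> u _; case: (dF u).
    by apply: cvg_at_right_filter; apply: cvgD; [exact: cvg_cst|exact: cvg_id].
  - by apply: cvg_addrl.
  - rewrite /F addr0; apply/continuous_within_itvcyP; split.
      move=> t; rewrite in_itv/= andbT => xt; apply: cG; exact: lt_trans xt.
    by apply: cvg_at_right_filter; exact: cG.
  - rewrite /F addr0 => t; rewrite in_itv/= andbT => xt.
    by rewrite divr_ge0 ?expR_ge0// ltW// (lt_trans x0).
have kE (u : R) : 0 <= u ->
    a * expR (- u) / (1 + a * u) = expR a^-1 * G (a^-1 + u).
  move=> u0; rewrite /G opprD expRD mulrA mulrA -expRD subrr expR0 mul1r.
  have n0 : 1 + a * u != 0 by rewrite gt_eqF// D0.
  have n1 : a^-1 + u != 0 by rewrite gt_eqF// ltr_wpDr.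
  by field; rewrite (mulrC u) n0 gt_eqF.
have mG : measurable_fun (`[0, +oo[%classic : set R) (fun u => G (a^-1 + u)).
  apply: subspace_continuous_measurable_fun => //.
  have cGF (u : R) : 0 <= u -> {for u, continuous (fun u => G (a^-1 + u))}.
    move=> u0; apply: continuous_comp; last by apply: cG; rewrite ltr_wpDr.
    by apply: cvgD; [exact: cvg_cst|exact: cvg_id].
  apply/continuous_within_itvcyP; split.
    by move=> u; rewrite in_itv/= andbT => /ltW; exact: cGF.
  by apply: cvg_at_right_filter; exact: cGF.
have G0 (u : R) : 0 <= u -> 0 <= G (a^-1 + u).
  by move=> u0; rewrite divr_ge0 ?expR_ge0// addr_ge0 ?(ltW x0).
transitivity ((expR a^-1)%:E * \int[mu]_(u in `[0%R, +oo[) (G (a^-1 + u))%:E)%E.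
  rewrite -ge0_integralZl_EFin ?expR_ge0//=.
  - apply: eq_integral => u; rewrite inE/= in_itv/= andbT => u0.
    by rewrite kE// EFinM.
  - by move=> u; rewrite /= in_itv/= andbT lee_fin; exact: G0.
  - exact/measurable_EFinP.
(* [Ei] is built on the real-valued integral, which defaults to [0] when the integral is infinite,
   so finiteness has to be shown; [a exp (- u)] dominates. *)
have fin : (\int[mu]_(u in `[0%R, +oo[) (G (a^-1 + u))%:E)%E \is a fin_num.
  rewrite ge0_fin_numE; last first.
    apply: integral_ge0 => u; rewrite /= in_itv/= andbT lee_fin; exact: G0.
  apply: (@le_lt_trans _ _ (\int[mu]_(u in `[0%R, +oo[) (a * expR (- u))%:E)%E).
    apply: ge0_le_integral => //=.
    - by move=> u; rewrite /= in_itv/= andbT lee_fin; exact: G0.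
    - exact/measurable_EFinP.
    - apply/measurable_EFinP; apply: measurable_funTS.
      by apply: measurable_funM => //; exact: measurableT_comp.
    - move=> u; rewrite /= in_itv/= andbT lee_fin => u0.
      rewrite /G mulrC opprD expRD ler_pM ?invr_ge0 ?mulr_ge0 ?expR_ge0//.
      + by rewrite addr_ge0// ltW.
      + by rewrite -lef_pV2 ?posrE ?invrK ?invr_gt0 ?lerDl// ltr_wpDr.
      + by rewrite ler_piMl ?expR_ge0// expR_le1 oppr_le0 ltW.
  under eq_integral do rewrite EFinM.
  rewrite ge0_integralZl_EFin ?(ltW a0)//=; last first.
    by apply/measurable_EFinP; apply: measurable_funTS; exact: measurableT_comp.
  have -> : (\int[mu]_(u in `[0%R, +oo[) (expR (- u))%:E = 1%:E)%E.
    have := @integral_exprn_expRN R 1 0 ltr01; rewrite fact0 expr1 divr1 => <-.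
    by apply: eq_integral => u _; rewrite expr0 !mul1r.
  by rewrite -EFinM ltry.
by rewrite /Ei opprK /Rintegral E mulrNN EFinM fineK.
Qed.

(** Integrating the derivative of [- kern k.+1 / a] over the half-line gives
    [J_k / a + (k + 1) J_(k+1) = 1], where [J_k] is the integral of [kern k.+1]. This is the
    recursion of [rate_coef] with [x = 1/a]. *)
Lemma integral_kernE (k : nat) :
  (\int[mu]_(u in `[0%R, +oo[) (a * expR (- u) / (1 + a * u) ^+ k.+1)%:E =
   (rate_coef a^-1 (- expR a^-1 * Ei (- a^-1)) k)%:E)%E.
Proof.
elim: k => [|k ih].
  rewrite -integral_kern1_Ei; apply: eq_integral => u _.
  by rewrite expr1.
rewrite /=; set J := rate_coef _ _ _ in ih *.
have : (\int[mu]_(u in `[0%R, +oo[)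
    (a^-1 * kern k.+1 u + k.+1%:R * kern k.+2 u)%:E = 1%:E)%E.
  transitivity ((0 - - (a^-1 * kern k.+1 0))%:E); last first.
    rewrite sub0r opprK /kern oppr0 expR0 mulr0 addr0 expr1n divr1 mulr1 mulVf//.
    by rewrite gt_eqF.
  have dF (u : R) : 0 <= u -> is_derive u 1 (fun u : R => - (a^-1 * kern k.+1 u))
      (a^-1 * kern k.+1 u + k.+1%:R * kern k.+2 u).
    move=> u0; have dk := is_derive_kern k.+1 u0.
    apply: is_derive_eq; rewrite /GRing.scale/=; field.
    by rewrite gt_eqF.
  apply: (ge0_integral_is_derive_y _ _ dF).
  - by move=> u u0; rewrite addr_ge0// mulr_ge0 ?kern_ge0 ?invr_ge0// ltW.
  - by move=> u u0; apply: cvgD; apply: cvgMr; exact: continuous_kern.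
  - rewrite -oppr0; apply: cvgN; rewrite -(mulr0 a^-1); apply: cvgMr.
    exact: kern_cvg0.
have mk j (c : R) : measurable_fun (`[0, +oo[%classic : set R) (fun u => (c * kern j u)%:E).
  by apply/measurable_EFinP; apply: measurable_funM.
have kn j : forall u, `[0%R, +oo[%classic u -> (0 <= (kern j u)%:E)%E.
  by move=> u; rewrite /= in_itv/= andbT lee_fin; exact: kern_ge0.
have mk1 j : measurable_fun (`[0, +oo[%classic : set R) (fun u => (kern j u)%:E).
  exact/measurable_EFinP.
under eq_integral do rewrite EFinD.
have ckn j (c : R) : 0 <= c ->
    forall u, `[0%R, +oo[%classic u -> (0 <= (c * kern j u)%:E)%E.
  by move=> c0 u /(kn j); rewrite !lee_fin => ku; rewrite mulr_ge0.
have x0 : 0 <= a^-1 by rewrite invr_ge0 ltW.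
rewrite ge0_integralD; [|by []|exact: ckn|exact: mk|exact: ckn|exact: mk].
under eq_integral do rewrite EFinM.
rewrite ge0_integralZl_EFin; [|by []|exact: kn|exact: mk1|by []].
have -> : (\int[mu]_(u in `[0%R, +oo[) (kern k.+1 u)%:E = J%:E)%E by exact: ih.
under eq_integral do rewrite EFinM.
rewrite ge0_integralZl_EFin; [|by []|exact: kn|exact: mk1|by []].
rewrite /kern; set I := integral _ _ _ => h.
(* An infinite [I] would make the left side of [h] infinite, whereas it equals [1]. *)
have fI : I \is a fin_num.
  rewrite ge0_fin_numE; last by apply: integral_ge0; exact: (kn k.+2).
  rewrite ltey; apply/eqP => Ioo; move: h.
  by rewrite Ioo gt0_muley ?lte_fin// addeC.
move: h; rewrite -(fineK fI) -!EFinM -EFinD => -[h].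
congr EFin; apply: (canRL (mulfK _)); first by rewrite pnatr_eq0.
by apply/esym/eqP; rewrite subr_eq addrC (mulrC (fine I)) h.
Qed.

Lemma integral_rate (M : nat) :
  (\int[mu]_(u in `]0%R, +oo[)
     ((1 - (1 + a * u) ^- M) * (expR (- u) / u))%:E =
   (\sum_(k < M) rate_coef a^-1 (- expR a^-1 * Ei (- a^-1)) k)%:E)%E.
Proof.
transitivity (\int[mu]_(u in `]0%R, +oo[) (\sum_(k < M) (kern k.+1 u)%:E))%E.
  apply: eq_integral => u; rewrite inE/= in_itv/= andbT => u0.
  rewrite sumEFin; congr EFin; set q := (1 + a * u)^-1.
  have n0 : 1 + a * u != 0 by rewrite gt_eqF// D0// ltW.
  have u1 : u != 0 by rewrite gt_eqF.
  (* Geometric sum in [q]; since [(1 - q) / u = a q], the singular factor [1 / u] disappears from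
     every term. *)
  rewrite -exprVn -/q -[1 - _]opprB subrX1 -mulNr opprB.
  rewrite mulr_sumr mulr_suml; apply: eq_bigr => k _.
  rewrite /kern -exprVn -/q exprS mulrAC [RHS]mulrA; congr (_ * _).
  by rewrite /q; field; rewrite u1 n0.
rewrite integral_itv_obnd_cbnd; last first.
  apply: emeasurable_sum => k; apply/measurable_EFinP.
  apply: measurable_funS (measurable_kern k.+1) => //.
  by move=> u; rewrite /= !in_itv/= !andbT; exact: ltW.
have kn k u : `[0%R, +oo[%classic u -> (0 <= (kern k u)%:E)%E.
  by rewrite /= in_itv/= andbT lee_fin; exact: kern_ge0.
rewrite ge0_integral_sum; [|by []|by move=> k; apply/measurable_EFinP; exact: measurable_kern|by move=> k; exact: kn].
by rewrite -sumEFin; apply: eq_bigr => k _; exact: integral_kernE.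
Qed.

End rate_integral.

(** * The layer cake formula *)

Section layer_cake.
Context {R : realType}.
Local Notation mu := (@lebesgue_measure R).

Lemma integral_superlevel (y : R) : 0 <= y <= 1 ->
  (\int[mu]_(t in `[0%R, 1%R]) (\1_[set t | (t < y)%R] t)%:E = y%:E)%E.
Proof.
move=> /andP[y0 y1].
have E : [set t : R | t < y] `&` `[0, 1] = `[0, y[%classic.
  apply/seteqP; split => t /=; rewrite !in_itv/=; first by move=> [-> /andP[->]].
  by move=> /andP[-> ty]; rewrite ty (ltW (lt_le_trans ty y1)).
rewrite integral_indic//.
  rewrite E; apply: etrans (lebesgue_measure_itv _) _ => /=.
  rewrite lte_fin oppr0 adde0; case: ltP => // yn.
  by congr EFin; apply/eqP; rewrite eq_le y0 yn.
by rewrite (_ : [set t | _] = `]-oo, y[%classic).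
Qed.

Context {d : measure_display} {T : measurableType d}.
Variable m : {sigma_finite_measure set T -> \bar R}.
Variables w f : T -> R.
Hypothesis mw : measurable_fun setT w.
Hypothesis w0 : forall x, 0 <= w x.
Hypothesis mf : measurable_fun setT f.
Hypothesis f01 : forall x, 0 <= f x <= 1.

(** The value [f x] is the length of the set of [t] in [[0, 1]] with [t < f x]; Tonelli then moves
    the integral over [t] outside. *)
Lemma layer_cake :
  (\int[m]_x (w x * f x)%:E =
   \int[mu]_(t in `[0%R, 1%R])
     \int[m]_x (w x * \1_[set x | (t < f x)%R] x)%:E)%E.
Proof.
pose A : set (T * measurableTypeR R)%type := [set z | z.2 < f z.1].
have mA : measurable A.
  have : measurable_fun setT (fun z : (T * measurableTypeR R)%type => z.2 < f z.1).
    by apply: measurable_fun_ltr => //; exact: measurableT_comp.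
  by move=> /(_ measurableT [set true] I); rewrite setTI.
have m1A : measurable_fun setT (fun z : (T * measurableTypeR R)%type => w z.1 * \1_A z).
  by apply: measurable_funM; [exact: measurableT_comp|exact: measurable_indic].
have EA x t : \1_[set t | (t < f x)%R] t = \1_A (x, t) :> R.
  by rewrite !indicE; congr (_%:R); apply/asboolP/asboolP.
transitivity (\int[m]_x \int[mu]_(t in `[0%R, 1%R]) (w x * \1_A (x, t))%:E)%E.
  apply: eq_integral => x _; under eq_integral do rewrite EFinM.
  rewrite ge0_integralZl_EFin//=.
  - have -> : (\int[mu]_(t in `[0%R, 1%R]) (\1_A (x, t))%:E = (f x)%:E)%E.
      rewrite -(integral_superlevel (f01 x)).
      by apply: eq_integral => t _; rewrite EA.
    by rewrite EFinM.
  - apply/measurable_EFinP; apply: measurable_funTS.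
    have h := @measurable_indic _ _ R setT _ (measurable_xsection x mA).
    apply: eq_measurable_fun h => t _.
    by rewrite !indicE mem_xsection.
rewrite (@fubini_tonelli_setX _ _ _ _ _ m mu setT _ (fun z => (w z.1 * \1_A z)%:E))//=.
- by apply/measurable_EFinP; exact: measurable_funTS.
- by move=> z _; rewrite lee_fin mulr_ge0.
Qed.

End layer_cake.

(** A substitute for approximation by simple functions: it reduces the passage to a Gaussian
    density, and later the factorization under independence, to statements about sets. *)
Lemma eq_integral_superlevel {R : realType} {d1 d2 : measure_display}
    {T1 : measurableType d1} {T2 : measurableType d2}
    (m1 : {sigma_finite_measure set T1 -> \bar R})
    (m2 : {sigma_finite_measure set T2 -> \bar R})
    (w1 f1 : T1 -> R) (w2 f2 : T2 -> R) :
  measurable_fun setT w1 -> (forall x, 0 <= w1 x) ->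
  measurable_fun setT f1 -> (forall x, 0 <= f1 x <= 1) ->
  measurable_fun setT w2 -> (forall x, 0 <= w2 x) ->
  measurable_fun setT f2 -> (forall x, 0 <= f2 x <= 1) ->
  (forall t, \int[m1]_x (w1 x * \1_[set x | (t < f1 x)%R] x)%:E =
             \int[m2]_x (w2 x * \1_[set x | (t < f2 x)%R] x)%:E)%E ->
  (\int[m1]_x (w1 x * f1 x)%:E = \int[m2]_x (w2 x * f2 x)%:E)%E.
Proof.
by move=> *; rewrite !layer_cake//; apply: eq_integral => t _.
Qed.

Lemma measurable_superlevel {R : realType} {d : measure_display}
    {T : measurableType d} (f : T -> R) (t : R) :
  measurable_fun setT f -> measurable [set x | t < f x].
Proof.
move=> mf; have : measurable_fun setT (fun x => t < f x) by exact: measurable_fun_ltr.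
by move=> /(_ measurableT [set true] I); rewrite setTI.
Qed.

(** * Laplace transforms of Gaussian squares *)

Section gaussian_laplace.
Context {R : realType}.
Local Notation mu := (@lebesgue_measure R).

(** Through superlevel sets the claim reduces to measures of sets, where it is the definition of
    [normal_prob] by its density. *)
Lemma integral_normal_prob01 (s : R) (f : R -> R) :
  measurable_fun setT f -> (forall x, 0 <= f x <= 1) ->
  (\int[normal_prob 0 s]_x (f x)%:E =
   \int[mu]_x (normal_pdf 0 s x * f x)%:E)%E.
Proof.
move=> mf f01.
transitivity (\int[normal_prob 0 s]_x (1 * f x)%:E)%E.
  by apply: eq_integral => x _; rewrite mul1r.
apply: eq_integral_superlevel => //.
- exact: measurable_normal_pdf.
- exact: normal_pdf_ge0.
- move=> t; have mA := measurable_superlevel t mf.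
  under eq_integral do rewrite mul1r.
  rewrite integral_indic// setIT.
  transitivity (\int[mu]_(x in [set x | (t < f x)%R]) (normal_pdf 0 s x)%:E)%E => //.
  rewrite integral_mkcond.
  by apply: eq_integral => x _; rewrite EFinM epatch_indic.
Qed.

(** The factor [exp (- c x^2)] turns the centred normal density of deviation [s] into the one of
    deviation [s'], where [1 / s'^2 = 1 / s^2 + 2 c], times the ratio of peaks
    [s' / s = D^(-1/2)]. *)
Lemma laplace_normal_sqr (s c : R) : 0 < s -> 0 <= c ->
  (\int[normal_prob 0 s]_x (expR (- (c * x ^+ 2)))%:E =
   ((Num.sqrt (1 + 2 * c * s ^+ 2))^-1)%:E)%E.
Proof.
move=> s0 c0.
rewrite integral_normal_prob01; last 2 first.
- apply: measurableT_comp => //; apply: measurableT_comp => //.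
  by apply: measurable_funM => //; exact: exprn_measurable.
- move=> x; rewrite expR_ge0/= expR_le1 oppr_le0.
  by rewrite mulr_ge0// sqr_ge0.
set D := 1 + 2 * c * s ^+ 2.
have D0 : 0 < D by rewrite ltr_wpDr// mulr_ge0 ?sqr_ge0// mulr_ge0.
pose s' := s / Num.sqrt D.
have sD0 : 0 < Num.sqrt D by rewrite sqrtr_gt0.
have s'0 : 0 < s' by rewrite divr_gt0.
have s'2 : s' ^+ 2 = s ^+ 2 / D by rewrite /s' expr_div_n sqr_sqrtr// ltW.
transitivity (((Num.sqrt D)^-1)%:E * \int[mu]_x (normal_pdf 0 s' x)%:E)%E; last first.
  by rewrite integral_normal_pdf mule1.
rewrite -ge0_integralZl_EFin ?invr_ge0 ?(ltW sD0)//=.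
- apply: eq_integral => x _; rewrite -EFinM; congr EFin.
  rewrite !normal_pdfE ?gt_eqF// /= /normal_peak /normal_fun.
  rewrite -mulrA -expRD [RHS]mulrA; congr (_ * expR _).
    rewrite -invfM -sqrtrM ?(ltW D0)// s'2; congr (Num.sqrt _)^-1.
    by field; rewrite gt_eqF.
  rewrite s'2 !subr0 /D; field.
  by rewrite -/D !gt_eqF.
- by move=> x _; rewrite lee_fin normal_pdf_ge0.
- by apply/measurable_EFinP; exact: measurable_normal_pdf.
Qed.

(** Tonelli separates the real and imaginary parts; as each has variance [alpha / 2], each
    contributes [(1 + alpha c)^(-1/2)]. *)
Lemma laplace_cgauss_prob (alpha c : R) : 0 < alpha -> 0 <= c ->
  (\int[normal_prob 0 (Num.sqrt (alpha / 2)) \x normal_prob 0 (Num.sqrt (alpha / 2))]_z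
    (expR (- (c * (z.1 ^+ 2 + z.2 ^+ 2))))%:E = ((1 + alpha * c)^-1)%:E)%E.
Proof.
move=> a0 c0; set s := Num.sqrt _.
have s0 : 0 < s by rewrite sqrtr_gt0 divr_gt0.
have sE : 1 + 2 * c * s ^+ 2 = 1 + alpha * c.
  by rewrite /s sqr_sqrtr ?divr_ge0 ?(ltW a0)//; field.
have D0 : 0 <= 1 + alpha * c by rewrite addr_ge0// mulr_ge0// ltW.
have mexp : measurable_fun setT (fun x : R => expR (- (c * x ^+ 2))).
  apply: measurableT_comp => //; apply: measurableT_comp => //.
  by apply: measurable_funM => //; exact: exprn_measurable.
rewrite fubini_tonelli1//=; last first.
- apply/measurable_EFinP; apply: measurableT_comp => //.
  apply: measurableT_comp => //; apply: measurable_funM => //.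
  apply: measurable_funD.
    by apply: (measurableT_comp (exprn_measurable 2)).
  by apply: (measurableT_comp (exprn_measurable 2)).
rewrite /fubini_F.
transitivity (\int[normal_prob 0 s]_x ((Num.sqrt (1 + alpha * c))^-1%:E *
    (expR (- (c * x ^+ 2)))%:E))%E.
  apply: eq_integral => x _ /=.
  under eq_integral do rewrite mulrDr opprD expRD EFinM.
  rewrite ge0_integralZl_EFin ?expR_ge0//=; last exact/measurable_EFinP.
  by rewrite laplace_normal_sqr// sE muleC.
rewrite ge0_integralZl_EFin ?invr_ge0 ?sqrtr_ge0//=; last exact/measurable_EFinP.
by rewrite laplace_normal_sqr// sE -EFinM -invfM -expr2 sqr_sqrtr.
Qed.

End gaussian_laplace.

(** * Expectation of a product over independent variables *)

Section independent_product.
Context {R : realType} {d d' : measure_display}.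
Context {T : measurableType d} {E : measurableType d'}.
Variable P : probability T R.

Lemma fin_num_integral01 (f : T -> R) :
  measurable_fun setT f -> (forall x, 0 <= f x <= 1) ->
  (\int[P]_x (f x)%:E)%E \is a fin_num.
Proof.
move=> mf f01.
have f0 x : 0 <= f x by case/andP: (f01 x).
rewrite ge0_fin_numE; last by apply: integral_ge0 => x _; rewrite lee_fin.
apply: (@le_lt_trans _ _ (\int[P]_x (cst 1 x))%E).
  apply: ge0_le_integral => //=.
  - by move=> x _; rewrite lee_fin.
  - exact/measurable_EFinP.
  - by move=> x _; rewrite lee_fin; case/andP: (f01 x).
by rewrite integral_cst//= mul1e probability_setT ltry.
Qed.

Variable M : nat.
Variable X : 'I_M -> T -> E.
Hypothesis mX : forall i, measurable_fun setT (X i).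
Hypothesis indX : mutually_independent P X.
Variable phi : E -> R.
Hypothesis mphi : measurable_fun setT phi.
Hypothesis phi01 : forall x, 0 <= phi x <= 1.

(* The first [k] factors are [phi (X i)], the others are indicators: the
   factors are converted one at a time, the layer cake formula turning a
   factor [phi (X k)] into indicators of its superlevel sets. *)
Let factor (k : nat) (B : 'I_M -> set E) (i : 'I_M) (w : T) : R :=
  if (i < k)%N then phi (X i w) else \1_(B i) (X i w).

Let mfactor k B i : (forall i, measurable (B i)) ->
  measurable_fun setT (factor k B i).
Proof.
move=> mB; rewrite /factor; case: (i < k)%N.
  exact: (measurableT_comp mphi (mX i)).
exact: (measurableT_comp (@measurable_indic _ _ R setT _ (mB i)) (mX i)).
Qed.

Let factor01 k B i w : 0 <= factor k B i w <= 1.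
Proof.
rewrite /factor; case: (i < k)%N; first exact: phi01.
by rewrite indicE; case: (X i w \in B i); rewrite /= ?ler01 ?lexx.
Qed.

Let expect (f : T -> R) : R := fine (\int[P]_x (f x)%:E)%E.

Let prod01 (Q : pred 'I_M) k B w : 0 <= \prod_(i | Q i) factor k B i w <= 1.
Proof.
elim/big_ind: _ => [|x y /andP[x0 x1] /andP[y0 y1]|i _].
- by rewrite ler01 lexx.
- by rewrite mulr_ge0// mulr_ile1.
- exact: factor01.
Qed.

Let expect_prod k : (k <= M)%N -> forall B, (forall i, measurable (B i)) ->
  (\int[P]_w (\prod_i factor k B i w)%:E = (\prod_i expect (factor k B i))%:E)%E.
Proof.
elim: k => [_ B mB|k ih kM B mB].
  have E1 i : expect (factor 0 B i) = fine (P (X i @^-1` B i)).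
    rewrite /expect /factor/=; congr fine.
    rewrite -[X in _ = P X]setIT -integral_indic//.
    rewrite -[X in measurable X]setTI; exact: mX.
  (* With indicators only, the product is the indicator of an intersection of events, and
     independence over the full index set applies. *)
  have -> : (\prod_i expect (factor 0 B i))%:E = (\prod_(i in finset.setTfor 'I_M) P (X i @^-1` B i))%E.
    rewrite -prodEFin; apply: eq_big => [i|i _]; first by rewrite finset.in_setT.
    by rewrite E1 fineK// fin_num_measure// -[X in measurable X]setTI; exact: mX.
  rewrite -indX//.
  set A := \bigcap_(i in _) _.
  have mA : measurable A.
    apply: fin_bigcap_measurable => // i _.
    rewrite -[X in measurable X]setTI; exact: mX.
  rewrite -[X in _ = P X]setIT -integral_indic//; apply: eq_integral => w _.
  congr EFin; rewrite indicE.
  have [wA|wA] := boolP (w \in A).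
    rewrite big1// => i _; rewrite /factor/= indicE mem_set//.
    by move/set_mem : wA => /(_ i); apply; rewrite /= finset.in_setT.
  have [i niB] : exists i, ~ B i (X i w).
    apply/existsNP => wB; move/negP: wA; apply.
    by apply/mem_set => i _; exact: wB.
  by rewrite (bigD1 i)//= /factor/= indicE memNset// mul0r.
pose j : 'I_M := Ordinal kM.
have factorE B' i : i != j -> factor k.+1 B' i = factor k B' i.
  move=> ij; rewrite /factor ltnS leq_eqVlt.
  by have -> : (nat_of_ord i == k) = false by apply/negbTE; rewrite -(inj_eq val_inj) in ij.
pose F w := \prod_(i | i != j) factor k B i w.
pose c := \prod_(i | i != j) expect (factor k B i).
have c0 : 0 <= c.
  apply: prodr_ge0 => i _; rewrite fine_ge0// integral_ge0// => w _.
  by rewrite lee_fin; case/andP: (factor01 k B i w).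
have mphiX : measurable_fun setT (fun w => phi (X j w)).
  exact: (measurableT_comp mphi (mX j)).
have -> : (\prod_i expect (factor k.+1 B i)) =
    c * expect (fun w => phi (X j w)).
  rewrite (bigD1 j)//= mulrC; congr (_ * expect _).
    by apply: eq_bigr => i ij; rewrite factorE.
  by rewrite /factor/= ltnSn.
transitivity (\int[P]_w (F w * phi (X j w))%:E)%E.
  apply: eq_integral => w _; congr EFin; rewrite (bigD1 j)//= mulrC.
  congr (_ * _); last by rewrite /factor/= ltnSn.
  by apply: eq_bigr => i ij; rewrite factorE.
transitivity (\int[P]_w (c * phi (X j w))%:E)%E; last first.
  under eq_integral do rewrite EFinM.
  rewrite ge0_integralZl_EFin//=.
  - rewrite EFinM /expect fineK//; apply: fin_num_integral01 => // w.
  - by move=> w _; rewrite lee_fin; case/andP: (phi01 (X j w)).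
  - exact/measurable_EFinP.
(* The weight is the random product [F] on one side and the constant [c] on the other, so only
   indicators of superlevel sets of [phi (X j)] remain to be compared. *)
apply: eq_integral_superlevel => //.
- rewrite /F; under eq_fun do rewrite big_mkcond/=.
  by apply: measurable_prod => i _; case: (i != j) => //; exact: mfactor.
- by move=> w; case/andP: (prod01 (fun i => i != j) k B w).
move=> t.
pose A := [set x | t < phi x].
(* Putting the superlevel set at position [j] makes the indicator a factor of level [k]; this is why
   the induction hypothesis quantifies over all [B]. *)
pose B' i := if i == j then A else B i.
have mB' i : measurable (B' i).
  by rewrite /B'; case: ifP => // _; exact: measurable_superlevel.
have factorB' i : i != j -> factor k B' i = factor k B i.
  by move=> ij; rewrite /factor /B' (negbTE ij).
have factorj w : factor k B' j w = \1_[set x | t < phi (X j x)] w.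
  rewrite /factor/= ltnn /B' eqxx !indicE.
  by congr (_%:R); apply/asboolP/asboolP.
have := ih (ltnW kM) B' mB'.
rewrite (bigD1 j)//= => h.
transitivity (\int[P]_w (\prod_i factor k B' i w)%:E)%E.
  apply: eq_integral => w _; congr EFin; rewrite (bigD1 j)//= mulrC factorj.
  by congr (_ * _); apply: eq_bigr => i ij; rewrite factorB'.
rewrite h mulrC; under [RHS]eq_integral do rewrite EFinM.
rewrite ge0_integralZl_EFin//=.
- rewrite EFinM; congr (_%:E * _)%E.
    by apply: eq_bigr => i ij; rewrite factorB'.
  rewrite /expect fineK; last by apply: fin_num_integral01 => [|w]; [exact: mfactor|exact: factor01].
  by apply: eq_integral => w _; rewrite factorj.
- apply/measurable_EFinP; apply: measurable_indic; exact: measurable_superlevel.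
Qed.

(** The conversion ends at [k = M], where no indicator is left. *)
Lemma expectation_prod_independent :
  (\int[P]_w (\prod_i phi (X i w))%:E =
   (\prod_i fine (\int[P]_w (phi (X i w))%:E)%E)%:E)%E.
Proof.
have := expect_prod (leqnn M) (B := fun=> setT) (fun=> measurableT).
rewrite /factor; under eq_integral do under eq_bigr do rewrite ltn_ord.
move=> ->; congr EFin; apply: eq_bigr => i _.
by rewrite ltn_ord.
Qed.

End independent_product.

(** * The squared norm of a complex Gaussian vector *)

Section cgauss_vector.
Context {R : realType} {d : measure_display} {T : measurableType d}.
Variables (P : probability T R) (M : nat) (alpha : R) (h : T -> 'cV[R[i]]_M).
Hypothesis alpha0 : 0 < alpha.
Hypothesis hh : is_cgauss_vector P alpha h.

Let entry (i : 'I_M) (w : T) := complex_pair (h w i ord0).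

Let q (z : measurableTypeR R * measurableTypeR R) : R := z.1 ^+ 2 + z.2 ^+ 2.

Let mq : measurable_fun setT q.
Proof.
by apply: measurable_funD; apply: (measurableT_comp (exprn_measurable 2)).
Qed.

Lemma norm2_sqrE (v : 'cV[R[i]]_M) :
  norm2 v ^+ 2 = \sum_i q (complex_pair (v i ord0)).
Proof.
rewrite /norm2 sqr_sqrtr; last by apply: sumr_ge0 => i _; exact: sqr_ge0.
apply: eq_bigr => i _; case: (v i ord0) => a b.
by rewrite /q /complex_pair/= sqr_sqrtr// addr_ge0// sqr_ge0.
Qed.

Lemma measurable_norm2_sqr : measurable_fun setT (fun w => norm2 (h w) ^+ 2).
Proof.
have [mh _ _] := hh.
under eq_fun do rewrite norm2_sqrE.
apply: measurable_sum => i; exact: (measurableT_comp mq (mh i)).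
Qed.

(** The exponential of the sum over the entries is a product of functions of single entries, valued
    in [[0, 1]] because [s >= 0]; independence splits its mean. *)
Lemma laplace_norm2_sqr (s : R) : 0 <= s ->
  (\int[P]_w (expR (- (s * norm2 (h w) ^+ 2)))%:E =
   ((1 + alpha * s) ^- M)%:E)%E.
Proof.
move=> s0; have [mh lawh indh] := hh.
pose phi z := expR (- (s * q z)).
have q0 z : 0 <= q z by rewrite addr_ge0// sqr_ge0.
have mphi : measurable_fun setT phi.
  apply: measurableT_comp => //; apply: measurableT_comp => //.
  exact: measurable_funM.
have phi01 z : 0 <= phi z <= 1.
  by rewrite expR_ge0/= expR_le1 oppr_le0 mulr_ge0.
have Ephi i : (\int[P]_w (phi (entry i w))%:E = ((1 + alpha * s)^-1)%:E)%E.
  rewrite -(laplace_cgauss_prob alpha0 s0).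
  have mphiE : measurable_fun setT (EFin \o phi) by exact/measurable_EFinP.
  have phi0 : {in setT, forall z, (0 <= (EFin \o phi) z)%E}.
    by move=> z _; rewrite lee_fin expR_ge0.
  (* The mean is transported to the law of the entry, which agrees with [cgauss_prob] on measurable
     sets. *)
  have := @ge0_integral_pushforward _ _ _ _ R (entry i) (mh i) P setT _ measurableT mphiE phi0.
  rewrite preimage_setT => <-.
  by apply: eq_measure_integral => [|mi A mA _]; [exact: (mh i)|exact: lawh].
transitivity (\int[P]_w (\prod_i phi (entry i w))%:E)%E.
  apply: eq_integral => w _; congr EFin.
  by rewrite norm2_sqrE mulr_sumr -sumrN expR_sum.
rewrite expectation_prod_independent//.
under eq_bigr do rewrite Ephi/=.
by rewrite prodr_const card_ord exprVn.
Qed.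

Lemma integral_ln1D_norm2_sqr (p : R) : 0 <= p ->
  (\int[P]_w (ln (1 + p * norm2 (h w) ^+ 2))%:E =
   \int[lebesgue_measure]_(u in `]0%R, +oo[)
     ((1 - (1 + p * alpha * u) ^- M) * (expR (- u) / u))%:E)%E.
Proof.
move=> p0.
transitivity (\int[P]_w (1 * ln (1 + p * norm2 (h w) ^+ 2))%:E)%E.
  by apply: eq_integral => w _; rewrite mul1r.
rewrite (@ge0_integral_ln1D_laplace _ _ _ P (cst 1) _ (fun s => (1 + alpha * s) ^- M))//.
- apply: eq_integral => u _; rewrite mulr0 addr0 expr1n invr1.
  by rewrite (mulrCA alpha) (mulrA p).
- exact: measurable_norm2_sqr.
- by move=> w; exact: sqr_ge0.
- move=> s s0; rewrite -(laplace_norm2_sqr s0); apply: eq_integral => w _.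
  by rewrite mul1r.
Qed.

Lemma ergodic_rateE (p : R) : 0 < p ->
  ergodic_rate P h p =
  ((ln 2)^-1%:E * \int[P]_w (ln (1 + p * norm2 (h w) ^+ 2))%:E)%E.
Proof.
move=> p0; rewrite /ergodic_rate unlock.
rewrite -ge0_integralZl_EFin//=.
- by apply: eq_integral => w _; rewrite /log2 mulrC EFinM.
- by move=> w _; rewrite lee_fin ln_ge0// lerDl mulr_ge0 ?sqr_ge0// ltW.
- apply/measurable_EFinP; apply: measurableT_comp => //.
  apply: measurable_funD => //; apply: measurable_funM => //.
  exact: measurable_norm2_sqr.
- by rewrite invr_ge0 ln_ge0// ler1n.
Qed.

End cgauss_vector.

(** * The gamma function and its derivative at a positive integer *)

Section gamma_derivative.
Context {R : realType}.
Local Notation mu := (@lebesgue_measure R).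

(** The antiderivative [4 t^(1/4)] bounds by [4] the integrals over [[1/(k+1), 1]], which avoid the
    singularity at [0]; these intervals exhaust []0, 1]]. *)
Lemma integral_powR_quarter_le :
  (\int[mu]_(t in `]0%R, 1%R]) (t `^ (- (3 / 4)))%:E <= 4%:E)%E.
Proof.
have E k : (\int[mu]_(t in `[(k.+1%:R^-1)%R, 1%R]) (t `^ (- (3 / 4)))%:E <= 4%:E)%E.
  have k0 : 0 < k.+1%:R^-1 :> R by rewrite invr_gt0.
  have [k1|k1] := leP 1 (k.+1%:R^-1 : R).
    move: k1; rewrite le_eqVlt => /predU1P[<-|k1].
      by rewrite set_itv1 integral_set1.
    by rewrite set_itv_ge ?integral_set0// -ltNge.
  pose F (t : R) := 4 * t `^ (1 / 4).
  have dF (t : R) : 0 < t -> is_derive t 1 F (t `^ (- (3 / 4))).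
    move=> t0; rewrite /F.
    have dp := is_derive1_powR (1 / 4) t0.
    apply: is_derive_eq; rewrite /GRing.scale/=.
    rewrite (_ : 1 / 4 - 1 = - (3 / 4) :> R); first by field.
    by field.
  have cf (t : R) : 0 < t -> {for t, continuous (fun t : R => t `^ (- (3 / 4)))}.
    move=> t0; apply: differentiable_continuous; apply/derivable1_diffP.
    by have dp := is_derive1_powR (- (3 / 4)) t0; exact: ex_derive.
  have pos (t : R) : k.+1%:R^-1 <= t <= 1 -> 0 < t.
    by move=> /andP[kt _]; exact: lt_le_trans kt.
  rewrite (integral_is_derive k1 (fun t h => cf t (pos t h)) (fun t h => dF t (pos t h))).
  rewrite lee_fin /F powR1 mulr1 gerBl mulr_ge0// powR_ge0.
rewrite itv_open_bnd_bigcup.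
pose B (k : nat) : set R := `[(0 + k.+1%:R^-1)%R, 1%R]%classic.
suff cB : (\int[mu]_(t in B k) (t `^ (- (3 / 4)))%:E)%E @[k --> \oo] -->
    (\int[mu]_(t in \bigcup_k B k) (t `^ (- (3 / 4)))%:E)%E.
  rewrite -(cvg_lim _ cB)//; apply: lime_le; first by apply/cvg_ex; eexists; exact: cB.
  by apply: nearW => k; rewrite /B add0r; exact: E.
apply: ge0_nondecreasing_set_cvg_integral => //.
- apply/nondecreasing_seqP => n; rewrite subsetEset => t/=.
  rewrite /B/= !in_itv/= !add0r => /andP[h ->]; rewrite andbT (le_trans _ h)//.
  by rewrite lef_pV2 ?posrE// ler_nat.
- by move=> k; exact: measurable_itv.
- by move=> k; apply/measurable_EFinP; apply: measurable_funTS; exact: measurable_powR.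
- by move=> k t _; rewrite lee_fin powR_ge0.
Qed.

Variable M : nat.
Hypothesis M0 : (1 <= M)%N.

Local Notation D := (`]0%R, +oo[%classic : set R).

(** An integrable majorant on [t > 0], uniform for [x] within [1/2] of [M], of the gamma integrand
    and of its derivative in [x]. Near [0], [t^(x-1) <= t^(-1/2)] and [|ln t| <= 4 t^(-1/4)] account
    for the exponent [-3/4]; the absolute value keeps the bound nonnegative on the whole line. *)
Definition gamma_bound (t : R) : R :=
  4 * (t `^ (- (3 / 4)) * \1_(`]0, 1]%classic : set R) t) + `|t| ^+ M.+1 * expR (- t).

Lemma gamma_bound_ge0 t : 0 <= gamma_bound t.
Proof.
rewrite addr_ge0// mulr_ge0 ?exprn_ge0 ?expR_ge0//.
by rewrite mulr_ge0 ?powR_ge0// indicE; case: (_ \in _).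
Qed.

Lemma integrable_gamma_bound : mu.-integrable D (EFin \o gamma_bound).
Proof.
have i1 : mu.-integrable D
    (fun t => (t `^ (- (3 / 4)) * \1_(`]0, 1]%classic : set R) t)%:E).
  apply/integrableP; split.
    apply/measurable_EFinP; apply: measurable_funTS; apply: measurable_funM.
      exact: measurable_powR.
    exact: measurable_indic.
  apply: (@le_lt_trans _ _ 4%:E); last by rewrite ltry.
  apply: le_trans integral_powR_quarter_le.
  rewrite [leRHS]integral_mkcond [leLHS]integral_mkcond.
  apply: ge0_le_integral => //=.
  - by move=> t _; apply: erestrict_ge0 => ? _; rewrite lee_fin normr_ge0.
  - apply/(measurable_restrictT _ _).1 => //; apply/measurable_EFinP.
    apply: measurable_funTS; apply: measurableT_comp => //; apply: measurable_funM.
      exact: measurable_powR.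
    exact: measurable_indic.
  - apply/(measurable_restrictT _ _).1 => //.
    by apply/measurable_EFinP; apply: measurable_funTS; exact: measurable_powR.
  - move=> t _; rewrite /patch indicE.
    by case: (t \in `]0, 1]%classic); case: ifP => _;
      rewrite ?mulr1 ?mulr0 ?normr0 ?lee_fin ?powR_ge0// ger0_norm ?powR_ge0.
have i2 : mu.-integrable D (fun t : R => (`|t| ^+ M.+1 * expR (- t))%:E).
  apply/integrableP; split.
    apply/measurable_EFinP; apply: measurable_funTS; apply: measurable_funM.
      by apply: (measurableT_comp (exprn_measurable M.+1)); exact: normr_measurable.
    exact: measurableT_comp.
  apply: (@le_lt_trans _ _ (\int[mu]_(t in D) (t ^+ M.+1 * expR (- (1 * t)))%:E)%E).
    rewrite le_eqVlt; apply/orP; left; apply/eqP; apply: eq_integral => t.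
    rewrite inE/= in_itv/= andbT => t0.
    by rewrite mul1r (gtr0_norm t0) ger0_norm// mulr_ge0 ?expR_ge0// exprn_ge0// ltW.
  by rewrite integral_exprn_expRN_oy// ltry.
exact: (integrableD _ (integrableZl _ 4 i1) i2).
Qed.

(** The maximum with [1] treats the gamma integrand and its product with [|ln t|] in a single
    estimate. For [t > 1], [ln t <= t] and [t^(x-1) <= t^M] give the power [t^(M+1)]. *)
Lemma powR_expRN_le_gamma_bound (x t : R) : 0 < t ->
  M%:R - 2^-1 <= x <= M%:R + 2^-1 ->
  Num.max 1 `|ln t| * (t `^ (x - 1) * expR (- t)) <= gamma_bound t.
Proof.
move=> t0 /andP[xl xr]; have M1 : 1 <= M%:R :> R by rewrite ler1n.
have e0 := expR_ge0 (- t).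
have p0 := powR_ge0 t (x - 1).
have pe0 : 0 <= t `^ (x - 1) * expR (- t) by rewrite mulr_ge0.
have m0 : 0 <= Num.max 1 `|ln t| by rewrite le_max ler01.
have [t1|t1] := leP t 1.
  have h1 : t `^ (x - 1) <= t `^ (- 2^-1).
    by apply: ger_powR; [rewrite t0|lra].
  have h2 : Num.max 1 `|ln t| <= 4 * t `^ (- (1 / 4)).
    have q1 : 1 <= t `^ (- (1 / 4)).
      by rewrite -[leLHS](powRr0 t); apply: ger_powR; [rewrite t0|lra].
    have q0 : 0 < t `^ (- (1 / 4)) by rewrite powR_gt0.
    rewrite ge_max; apply/andP; split; first by lra.
    rewrite ler0_norm ?ln_le0//.
    (* The inequality [ln y < y] at [y = t^(-1/4)], multiplied by [4]. *)
    have := ln_sublinear q0; rewrite ln_powR; lra.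
  rewrite -[leLHS]addr0; apply: lerD; last by rewrite mulr_ge0// exprn_ge0.
  rewrite indicE mem_set ?mulr1; last by rewrite /= in_itv/= t0.
  have -> : t `^ (- (3 / 4)) = t `^ (- (1 / 4)) * t `^ (- 2^-1).
    rewrite -powRD; last by rewrite (gt_eqF t0) implybT.
    by congr (_ `^ _); field.
  rewrite [leRHS]mulrA; apply: ler_pM => //.
    by apply: le_trans h1; rewrite ler_piMr// expR_le1 oppr_le0 ltW.
have h1 : t `^ (x - 1) <= t ^+ M.
  by rewrite -powR_mulrn ?(ltW t0)//; apply: ler_powR; [exact: ltW|lra].
have h2 : Num.max 1 `|ln t| <= t.
  rewrite ge_max (ltW t1)/= ger0_norm ?ln_ge0 ?(ltW t1)//.
  by rewrite ltW// ln_sublinear.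
rewrite -[leLHS]add0r; apply: lerD.
  by rewrite !mulr_ge0 ?powR_ge0// indicE; case: (_ \in _).
rewrite (gtr0_norm t0) exprS -mulrA; apply: ler_pM => //.
by rewrite ler_wpM2r.
Qed.

Let measurable_gamma_integrand x :
  measurable_fun D (fun t : R => t `^ (x - 1) * expR (- t)).
Proof.
apply: measurable_funTS; apply: measurable_funM; first exact: measurable_powR.
exact: measurableT_comp.
Qed.

Lemma integrable_gamma_le (f : R -> R) (k : R) : 0 <= k ->
  measurable_fun D f -> (forall t, 0 < t -> `|f t| <= k * gamma_bound t) ->
  mu.-integrable D (EFin \o f).
Proof.
move=> k0 mf fle.
apply: (@le_integrable _ _ _ mu D _ _ (fun t => k%:E * (EFin \o gamma_bound) t)%E) => //.
- exact/measurable_EFinP.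
- move=> t; rewrite /= in_itv/= andbT => t0.
  rewrite lee_fin (le_trans (fle _ t0))// ger0_norm// mulr_ge0//.
  exact: gamma_bound_ge0.
- by apply: integrableZl => //; exact: integrable_gamma_bound.
Qed.

Lemma integrable_gamma (x : R) : M%:R - 2^-1 <= x <= M%:R + 2^-1 ->
  mu.-integrable D (EFin \o (fun t : R => t `^ (x - 1) * expR (- t))).
Proof.
move=> hx; apply: (@integrable_gamma_le _ 1) => // t t0.
rewrite ger0_norm ?mulr_ge0 ?powR_ge0 ?expR_ge0// mul1r.
apply: le_trans (powR_expRN_le_gamma_bound t0 hx).
by rewrite ler_peMl ?mulr_ge0 ?powR_ge0 ?expR_ge0// le_max lexx.
Qed.

Lemma ln_gamma_le (x t : R) : 0 < t -> M%:R - 2^-1 <= x <= M%:R + 2^-1 ->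
  `|ln t * (t `^ (x - 1) * expR (- t))| <= gamma_bound t.
Proof.
move=> t0 hx; apply: le_trans (powR_expRN_le_gamma_bound t0 hx).
have e0 : 0 <= t `^ (x - 1) * expR (- t) by rewrite mulr_ge0 ?powR_ge0 ?expR_ge0.
by rewrite normrM (ger0_norm e0) ler_wpM2r// le_max lexx orbT.
Qed.

Lemma integrable_ln_gamma :
  mu.-integrable D (EFin \o (fun t : R => ln t * (t `^ (M%:R - 1) * expR (- t)))).
Proof.
apply: (@integrable_gamma_le _ 1) => //.
  apply: measurable_funM; last exact: measurable_gamma_integrand.
  by apply: measurable_funTS; exact: measurable_ln.
by move=> t t0; rewrite mul1r; apply: ln_gamma_le => //; apply/andP; split; lra.
Qed.

Lemma is_derive_gamma_integrand (x t : R) : 0 < t ->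
  is_derive x 1 (fun y => t `^ (y - 1) * expR (- t))
    (ln t * (t `^ (x - 1) * expR (- t))).
Proof.
move=> t0.
have E y : t `^ (y - 1) = expR ((y - 1) * ln t) by rewrite /powR gt_eqF.
under eq_fun do rewrite E.
by rewrite E; apply: is_derive_eq; rewrite /GRing.scale/=; ring.
Qed.

(** Differentiation under the integral on the open interval of radius [1/2] about [M], dominated by
    [gamma_bound]. *)
Lemma is_derive_Gamma :
  is_derive (M%:R : R) 1 (@Gamma R)
    (\int[mu]_(t in D) (ln t * (t `^ (M%:R - 1) * expR (- t)))).
Proof.
pose f (x t : R) := t `^ (x - 1) * expR (- t).
have Ia : (`]M%:R - 2^-1, M%:R + 2^-1[%classic : set R) M%:R.
  by rewrite /= in_itv/=; apply/andP; split; lra.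
have intf x : (`]M%:R - 2^-1, M%:R + 2^-1[%classic : set R) x ->
    mu.-integrable D (EFin \o f x).
  rewrite /= in_itv/= => /andP[/ltW h1 /ltW h2].
  by apply: integrable_gamma; rewrite h1.
have df x y : (`]M%:R - 2^-1, M%:R + 2^-1[%classic : set R) x -> D y ->
    derivable (f ^~ y) x 1.
  move=> _; rewrite /= in_itv/= andbT => y0.
  by case: (is_derive_gamma_integrand x y0).
have dfE x y : 0 < y -> partial1of2 f x y = ln y * (y `^ (x - 1) * expR (- y)).
  by move=> y0; rewrite partial1of2E; case: (is_derive_gamma_integrand x y0).
have dfle x y : (`]M%:R - 2^-1, M%:R + 2^-1[%classic : set R) x -> D y ->
    `|partial1of2 f x y| <= gamma_bound y.
  rewrite /= !in_itv/= andbT => /andP[/ltW h1 /ltW h2] y0.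
  by rewrite dfE//; apply: ln_gamma_le => //; rewrite h1.
have mD : measurable (D : set (measurableTypeR R)) by exact: measurable_itv.
split.
  exact: (derivable_under_integral mD Ia intf df gamma_bound_ge0 integrable_gamma_bound dfle).
rewrite -derive1E.
have := differentiation_under_integral mD Ia intf df gamma_bound_ge0 integrable_gamma_bound dfle.
move=> ->; apply: eq_Rintegral => t; rewrite inE/= in_itv/= andbT => t0.
exact: dfE.
Qed.

Lemma Gamma_natE : Gamma (M%:R : R) = (M.-1)`!%:R.
Proof.
transitivity ((M.-1)`!%:R / 1 ^+ M.-1.+1 : R); last by rewrite expr1n divr1.
apply: EFin_inj; rewrite -integral_exprn_expRN_oy// /Gamma /Rintegral fineK.
  apply: eq_integral => t; rewrite inE/= in_itv/= andbT => t0.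
  by rewrite mul1r -(@natrB _ M 1)// subn1 powR_mulrn// ltW.
by apply: integrable_fin_num => //; apply: integrable_gamma; apply/andP; split; lra.
Qed.

(** The chain rule gives [Gamma' / Gamma], which is the mean of [ln G] for [G] of law Gamma(M,
    1). *)
Lemma digamma_natE : digamma (M%:R : R) =
  (\int[mu]_(t in D) (ln t * (t `^ (M%:R - 1) * expR (- t)))) / (M.-1)`!%:R.
Proof.
have c0 : 0 < Gamma (M%:R : R) by rewrite Gamma_natE ltr0n fact_gt0.
have dG := is_derive_Gamma.
have dl := is_derive1_ln c0.
have h := is_derive1_comp dl dG.
by rewrite /digamma derive1E -Gamma_natE mulrC; case: h.
Qed.

End gamma_derivative.

(** * Comparison with a gamma variable and the error at high power *)

(** From [1 + y <= (1 + sqrt y)^2] and [ln (1 + s) <= s]. The square root matters: with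
    [ln (1 + y) <= y] the error bound would involve the mean of [1 / G], which is infinite for
    [M = 1]. *)
Lemma ln1D_le_sqrt {R : realType} (y : R) : 0 <= y -> ln (1 + y) <= 2 * Num.sqrt y.
Proof.
move=> y0; have s0 := sqrtr_ge0 y.
have s1 : 0 < 1 + Num.sqrt y by rewrite ltr_wpDr.
apply: (@le_trans _ _ (ln ((1 + Num.sqrt y) ^+ 2))).
  rewrite ler_ln ?posrE ?exprn_gt0 ?ltr_wpDr//.
  by rewrite sqrrD expr1n sqr_sqrtr// mul1r lerD2r lerDl mulrn_wge0.
rewrite lnXn// -[leLHS]mulr_natl ler_wpM2l//.
by rewrite le_ln1Dx// (lt_le_trans _ s0)// ltrN10.
Qed.

Section gamma_law.
Context {R : realType}.
Local Notation mu := (@lebesgue_measure R).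
Local Notation D := (`]0%R, +oo[%classic : set R).
Variable M : nat.
Hypothesis M0 : (1 <= M)%N.

(** On [t > 0], [w / c] is the density of the law Gamma(M, 1). *)
Let w (t : R) : R := t `^ (M%:R - 1) * expR (- t).
Let c : R := (M.-1)`!%:R.

Let c0 : 0 < c. Proof. by rewrite ltr0n fact_gt0. Qed.

Let wE t : 0 < t -> w t = t ^+ M.-1 * expR (- t).
Proof.
by move=> t0; rewrite /w -(@natrB _ M 1)// subn1 powR_mulrn// ltW.
Qed.

Let w_ge0 t : 0 <= w t.
Proof. by rewrite mulr_ge0 ?powR_ge0 ?expR_ge0. Qed.

Let mw : measurable_fun setT w.
Proof.
by apply: measurable_funM; [exact: measurable_powR|exact: measurableT_comp].
Qed.

Let integral_restr (g : R -> R) :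
  (\int[mu]_t (g t * \1_D t)%:E = \int[mu]_(t in D) (g t)%:E)%E.
Proof.
rewrite [RHS]integral_mkcond; apply: eq_integral => t _.
by rewrite EFinM epatch_indic.
Qed.

Lemma integral_ln1D_gamma (a : R) : 0 <= a ->
  (\int[mu]_(t in D) (c^-1 * (w t * ln (1 + a * t)))%:E =
   \int[mu]_(u in `]0%R, +oo[)
     ((1 - (1 + a * u) ^- M) * (expR (- u) / u))%:E)%E.
Proof.
move=> a0.
(* The Laplace transform argument integrates over the whole space a variable that is nonnegative
   everywhere, hence the indicator in the weight and [|t|] in place of [t]. *)
transitivity (\int[mu]_t (c^-1 * w t * \1_D t * ln (1 + a * `|t|))%:E)%E.
  rewrite -integral_restr; apply: eq_integral => t _; congr EFin.
  rewrite indicE; have [tD|tD] := boolP (t \in D); last by rewrite !mulr0 mul0r.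
  have t0 : 0 < t by move: tD; rewrite inE/= in_itv/= andbT.
  by rewrite (gtr0_norm t0) !mulr1 mulrA.
rewrite (@ge0_integral_ln1D_laplace _ _ _ mu (fun t => c^-1 * w t * \1_D t)
  (fun t => `|t|) (fun s => (1 + s) ^- M) a)//.
- by apply: eq_integral => u _; rewrite addr0 expr1n invr1.
- apply: measurable_funM; first exact: measurable_funM.
  exact: measurable_indic.
- exact: normr_measurable.
- by move=> t; rewrite !mulr_ge0 ?powR_ge0 ?expR_ge0 ?invr_ge0 ?(ltW c0).
- move=> s s0.
  transitivity (\int[mu]_(t in D) (c^-1%:E * (t ^+ M.-1 * expR (- ((1 + s) * t)))%:E))%E.
    rewrite -[RHS](integral_restr (fun t => c^-1 * (t ^+ M.-1 * expR (- ((1 + s) * t))))).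
    apply: eq_integral => t _; congr EFin.
    rewrite indicE; have [tD|tD] := boolP (t \in D); last by rewrite !mulr0 mul0r.
    have t0 : 0 < t by move: tD; rewrite inE/= in_itv/= andbT.
    rewrite (gtr0_norm t0) !mulr1 wE// -!mulrA -expRD; congr (_ * (_ * expR _)).
    ring.
  rewrite ge0_integralZl_EFin ?invr_ge0 ?(ltW c0)//=; last 2 first.
  - by move=> t; rewrite /= in_itv/= andbT lee_fin => t0; rewrite mulr_ge0 ?expR_ge0// exprn_ge0// ltW.
  - apply/measurable_EFinP; apply: measurable_funTS; apply: measurable_funM.
      exact: exprn_measurable.
    by apply: measurableT_comp => //; apply: measurableT_comp => //.
  rewrite integral_exprn_expRN_oy ?ltr_wpDr// prednK// -EFinM mulrA mulVf ?mul1r//.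
  by rewrite gt_eqF.
Qed.

(* [E ln (1 + 1 / (a G))] for [G] of law Gamma(M, 1): the gap between
   [E ln (1 + a G)] and [ln a + E ln G]. *)
Definition gamma_err (a : R) : R := c^-1 * \int[mu]_(t in D) (w t * ln (1 + (a * t)^-1)).

Let half_le : (M%:R : R) - 2^-1 <= (M%:R : R) - 2^-1 <= M%:R + 2^-1.
Proof. by apply/andP; split; lra. Qed.

Let mid_le : (M%:R : R) - 2^-1 <= (M%:R : R) <= M%:R + 2^-1.
Proof. by apply/andP; split; lra. Qed.

(** The square-root bound on the logarithm multiplies [w t] by [t^(-1/2)], which gives the gamma
    integrand at [x = M - 1/2], the lower end of the range covered by [gamma_bound]. *)
Let gamma_err_integrand_le (a t : R) : 0 < a -> 0 < t ->
  0 <= w t * ln (1 + (a * t)^-1) <= 2 * Num.sqrt a^-1 * gamma_bound M t.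
Proof.
move=> a0 t0; have y0 : 0 <= (a * t)^-1 by rewrite invr_ge0 mulr_ge0// ltW.
rewrite mulr_ge0 ?ln_ge0 ?lerDl//=.
apply: le_trans (ler_wpM2l (w_ge0 t) (ln1D_le_sqrt y0)) _.
have st : Num.sqrt t^-1 = t `^ (- 2^-1).
  by rewrite -powR12_sqrt ?invr_ge0 ?(ltW t0)// -powR_inv1 ?(ltW t0)// -powRrM mulN1r.
rewrite invfM sqrtrM ?invr_ge0 ?(ltW a0)// st.
rewrite (_ : w t * _ = 2 * Num.sqrt a^-1 * (w t * t `^ (- 2^-1))); last by ring.
rewrite ler_wpM2l ?mulr_ge0 ?sqrtr_ge0//.
apply: le_trans (powR_expRN_le_gamma_bound M0 t0 half_le).
rewrite (_ : w t * _ = t `^ (M%:R - 2^-1 - 1) * expR (- t)).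
  by rewrite ler_peMl ?mulr_ge0 ?powR_ge0 ?expR_ge0// le_max lexx.
rewrite /w mulrAC -powRD; last by rewrite (gt_eqF t0) implybT.
by rewrite addrAC.
Qed.

Let integrable_gamma_err (a : R) : 0 < a ->
  mu.-integrable D (EFin \o (fun t => w t * ln (1 + (a * t)^-1))).
Proof.
move=> a0; apply: (@integrable_gamma_le _ M _ (2 * Num.sqrt a^-1)).
- by rewrite mulr_ge0 ?sqrtr_ge0.
- apply: measurable_funM; first exact: measurable_funTS.
  apply: measurableT_comp; first exact: measurable_ln.
  apply: measurable_funD => //.
  rewrite (_ : (fun _ => _) = (fun t => a^-1 * t^-1)); last first.
    by apply/funext => t; rewrite invfM.
  by apply: measurable_funM => //; exact: measurable_invr_pos.
- move=> t t0; have /andP[h1 h2] := gamma_err_integrand_le a0 t0.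
  by rewrite ger0_norm.
Qed.

(** Pointwise, [ln (1 + a t) = ln a + ln t + ln (1 + 1/(a t))]; the three means are [ln a], [psi(M)]
    and the error term. *)
Lemma integral_ln1D_gammaE (a : R) : 0 < a ->
  (\int[mu]_(t in D) (c^-1 * (w t * ln (1 + a * t)))%:E =
   (ln a + digamma M%:R + gamma_err a)%:E)%E.
Proof.
move=> a0; have mD : measurable (D : set (measurableTypeR R)) by exact: measurable_itv.
have i1 : mu.-integrable D (EFin \o w) := integrable_gamma M0 mid_le.
have i2 := @integrable_ln_gamma R M M0.
have i3 := integrable_gamma_err a0.
have i1' : mu.-integrable D (EFin \o (fun t => ln a * w t)).
  exact: (integrableZl _ (ln a) i1).
have i12 : mu.-integrable D (EFin \o (fun t => ln a * w t + ln t * w t)).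
  exact: (integrableD _ i1' i2).
pose g t := ln a * w t + ln t * w t + w t * ln (1 + (a * t)^-1).
have i123 : mu.-integrable D (EFin \o g).
  exact: (integrableD _ i12 i3).
have i4 : mu.-integrable D (EFin \o (fun t => c^-1 * g t)).
  exact: (integrableZl _ c^-1 i123).
transitivity (\int[mu]_(t in D) (c^-1 * g t)%:E)%E.
  apply: eq_integral => t; rewrite inE/= in_itv/= andbT => t0; congr EFin.
  congr (_ * _); rewrite /g.
  have at0 : 0 < a * t by rewrite mulr_gt0.
  have -> : 1 + a * t = a * t * (1 + (a * t)^-1) by field; rewrite !gt_eqF.
  rewrite lnM ?posrE//; last by rewrite ltr_wpDr ?invr_ge0// ltW.
  by rewrite lnM ?posrE//; ring.
rewrite -[LHS]fineK; last exact: integrable_fin_num.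
congr EFin; rewrite -/(Rintegral mu D (fun t => c^-1 * g t)).
rewrite RintegralZl// RintegralD// RintegralD// RintegralZl//.
rewrite digamma_natE// -/c /gamma_err.
have -> : \int[mu]_(t in D) w t = c by rewrite /c -(Gamma_natE M0).
by rewrite /w; field; rewrite gt_eqF.
Qed.

Lemma gamma_err_le (a : R) : 0 < a ->
  0 <= gamma_err a <= c^-1 * (2 * \int[mu]_(t in D) gamma_bound M t) * Num.sqrt a^-1.
Proof.
move=> a0; have mD : measurable (D : set (measurableTypeR R)) by exact: measurable_itv.
have ci0 : 0 <= c^-1 by rewrite invr_ge0 ltW.
apply/andP; split.
  rewrite mulr_ge0//; apply: Rintegral_ge0 => t; rewrite /= in_itv/= andbT => t0.
  by case/andP: (gamma_err_integrand_le a0 t0).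
rewrite -mulrA ler_wpM2l// mulrAC.
rewrite -RintegralZl//; last exact: integrable_gamma_bound.
apply: le_Rintegral => //.
- exact: integrable_gamma_err.
- exact: (integrableZl _ _ (integrable_gamma_bound M)).
- move=> t; rewrite /= in_itv/= andbT => t0.
  by case/andP: (gamma_err_integrand_le a0 t0).
Qed.

Lemma gamma_err_cvg0 (alpha : R) : 0 < alpha -> gamma_err (p * alpha) @[p --> +oo] --> (0 : R).
Proof.
move=> al0; set K := c^-1 * (2 * \int[mu]_(t in D) gamma_bound M t).
have h : K * Num.sqrt (p * alpha)^-1 @[p --> +oo] --> (0 : R).
  rewrite -(mulr0 K); apply: cvgMr; rewrite -[X in _ --> X](sqrtr0 R).
  apply: (@cvg_comp _ _ _ _ (@Num.sqrt R) _ (nbhs (0 : R))); last exact: sqrt_continuous.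
  apply/gtr0_cvgV0; last exact: gt0_cvgMly.
  near=> p; rewrite mulr_gt0//; near: p; apply: nbhs_pinfty_gt; rewrite num_real.
apply: (@squeeze_cvgr _ _ _ _ (fun=> 0) (fun p => K * Num.sqrt (p * alpha)^-1)) => //.
  near=> p; have p0 : 0 < p by near: p; apply: nbhs_pinfty_gt; rewrite num_real.
  by apply: gamma_err_le; rewrite mulr_gt0.
exact: cvg_cst.
Unshelve. all: by end_near. Qed.

End gamma_law.

(** * Closed form and high-power limit of the ergodic rate *)

Theorem theorem1 (R : realType) (d : measure_display) (T : measurableType d)
    (P : probability T R) (M : nat) (alpha : R) (h : T -> 'cV[R[i]]_M)
    (hM : (1 <= M)%N) (halpha : 0 < alpha)
    (hh : is_cgauss_vector P alpha h) :
  (forall p : R, 0 < p ->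
     ergodic_rate P h p =
     (\sum_(0 <= mu < M)
        (- 1 / (p * alpha)) ^+ (M - 1 - mu) / ((M - 1 - mu)`!%:R * ln 2) *
        (- expR (1 / (p * alpha)) * Ei (- 1 / (p * alpha)) +
         \sum_(1 <= i < (M - 1 - mu).+1)
            (i - 1)`!%:R * (- (1 / (p * alpha))) ^- i))%:E) /\
  (ergodic_rate P h p - (log2 p + log2 alpha + digamma M%:R / ln 2)%:E)%E
    @[p --> +oo] --> 0%E.
Proof.
split.
  move=> p p0; have a0 : 0 < p * alpha by rewrite mulr_gt0.
  rewrite (ergodic_rateE hh p0) (integral_ln1D_norm2_sqr halpha hh (ltW p0)).
  rewrite (integral_rate a0) -EFinM; congr EFin.
  (* The sum is reversed, so that the index [M - 1 - mu] becomes [k]. *)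
  rewrite big_nat_rev/= big_mkord mulr_sumr; apply: eq_bigr => k _.
  have -> : (M - 1 - (0 + M - k.+1))%N = k.
    rewrite add0n -[k.+1]add1n subnDA subKn// subn1 -ltnS prednK//.
  rewrite rate_coefE ?invr_eq0 ?gt_eqF// mulN1r div1r.
  by rewrite (invfM _ (ln 2)); ring.
have cvg_err := gamma_err_cvg0 hM halpha.
(* For [p > 0] the difference is exactly the error term over [ln 2], so its limit is read off from
   that of [gamma_err]. *)
have near_eq : \forall p \near +oo,
    ((gamma_err M (p * alpha) / ln 2)%:E =
     ergodic_rate P h p - (log2 p + log2 alpha + digamma M%:R / ln 2)%:E)%E.
  near=> p.
  have p0 : 0 < p by near: p; apply: nbhs_pinfty_gt; rewrite num_real.
  have a0 : 0 < p * alpha by rewrite mulr_gt0.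
  rewrite (ergodic_rateE hh p0) (integral_ln1D_norm2_sqr halpha hh (ltW p0)).
  (* The same integral over [u] represents the means of [ln (1 + p ||h||^2)] and of
     [ln (1 + p alpha G)], so the first is exchanged for the second. *)
  rewrite -(integral_ln1D_gamma hM (ltW a0)) (integral_ln1D_gammaE hM a0).
  rewrite -EFinM -EFinB; congr EFin.
  by rewrite /log2 lnM ?posrE//; ring.
apply: cvg_trans (near_eq_cvg near_eq) _.
apply: cvg_EFin; first by near=> p.
rewrite /comp/= -(mul0r (ln 2)^-1); exact: cvgMl.
Unshelve. all: by end_near. Qed.
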